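(* Let $[x_k]=(x_0,\ldots,x_N)$ be a zero-mean nonsingular Gaussian (ZMNG) sequence of $\mathbb{R}^d$-valued random vectors. Then $[x_k]$ is reciprocal if and only if it can be represented as both $$x_k=y^L_k+\Gamma^L_kx_N,\quad k\in[0,N-1],$$ and $$x_k=y^F_k+\Gamma^F_kx_0,\quad k\in[1,N],$$ where $(y^L_k)_{k\in[0,N-1]}$ and $(y^F_k)_{k\in[1,N]}$ are ZMNG Markov sequences, $x_N$ and $x_0$ are ZMNG vectors uncorrelated with $(y^L_k)_{k\in[0,N-1]}$ and $(y^F_k)_{k\in[1,N]}$, respectively, and $\Gamma^L_k$ and $\Gamma^F_k$ are some ($d\times d$) matrices.
   Context: $N$ is a positive integer and $[i,j]=\{i,i+1,\ldots,j\}$; $[x_k]$ denotes $(x_k)_{k\in[0,N]}$. A sequence (or vector) is zero-mean nonsingular Gaussian (ZMNG) if the stacked vector of all its terms is jointly Gaussian with zero mean and nonsingular covariance matrix. A sequence indexed by an interval of integers is Markov if, conditioned on the state at any time $k$, the segment before $k$ is independent of the segment after $k$ (sequences of length less than 3 are Markov). A sequence $[x_k]$ is reciprocal if, conditioned on the states at any two times $j<l$, the segment inside $(j,l)$ is independent of the two segments outside $[j,l]$; equivalently, the conditional distribution of $x_k$ given $(x_0,\ldots,x_j,x_l,\ldots,x_N)$ equals that given $(x_j,x_l)$ for all $j<k<l$ in $[0,N]$. *)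

(* Defs.v *)
From HB Require Import structures.
From mathcomp Require Import all_boot all_order all_algebra.
From mathcomp Require Import all_classical all_reals all_analysis.

Set Implicit Arguments.
Unset Strict Implicit.
Unset Printing Implicit Defensive.

Import Order.TTheory GRing.Theory Num.Theory.
Import numFieldNormedType.Exports.

Local Open Scope classical_set_scope.
Local Open Scope ring_scope.

(* A random vector in R^n is a function T -> 'cV[R]_n whose coordinates are
   measurable; a sequence of n random vectors in R^d is indexed by 'I_n. *)

Section gaussian.
Context {disp : measure_display} {T : measurableType disp} {R : realType}.
Variable P : probability T R.

(* N(m, s^2); the case s = 0 is separated because [normal_prob m 0] is not the
   point mass at m in the library. *)
Definition gaussian_law (m s : R) (B : set R) : \bar R :=
  if s == 0 then \d_m B else normal_prob m s B.

Definition gaussian (X : T -> R) : Prop :=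
  measurable_fun [set: T] X /\
  exists m s : R, 0 <= s /\
    forall B : set R, measurable B -> P (X @^-1` B) = gaussian_law m s B.

(* Taking for a the rows of the identity matrix yields in particular that every
   coordinate of X is measurable and Gaussian. *)
Definition jointly_gaussian n (X : T -> 'cV[R]_n) : Prop :=
  forall a : 'rV[R]_n, gaussian (fun w => (a *m X w) 0 0).

Definition zero_mean n (X : T -> 'cV[R]_n) : Prop :=
  forall i, ('E_P[(fun w => X w i 0)%R] = 0)%E.

Definition covariance_mx m n (X : T -> 'cV[R]_m) (Y : T -> 'cV[R]_n) :
    'M[\bar R]_(m, n) :=
  \matrix_(i, j) covariance P (fun w => X w i 0) (fun w => Y w j 0).

Definition ZMNG n (X : T -> 'cV[R]_n) : Prop :=
  [/\ jointly_gaussian X, zero_mean X &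
      map_mx fine (covariance_mx X X) \in unitmx].

Definition stacked n d (x : 'I_n -> T -> 'cV[R]_d) (w : T) : 'cV[R]_(n * d) :=
  (mxvec (\matrix_(k < n, i < d) x k w i 0))^T.

Definition ZMNG_sequence n d (x : 'I_n -> T -> 'cV[R]_d) : Prop :=
  ZMNG (stacked x).

Definition uncorrelated_vectors m n (X : T -> 'cV[R]_m) (Y : T -> 'cV[R]_n) : Prop :=
  forall i j, covariance_mx X Y i j = 0%E.

End gaussian.

Section conditional_independence.
Context {disp : measure_display} {T : measurableType disp} {R : realType}.
Variable P : probability T R.

(* f is a version of the conditional probability P(A | G) *)
Definition cond_probability (G : set (set T)) (A : set T) (f : T -> R) : Prop :=
  [/\ forall B : set R, measurable B -> G (f @^-1` B),
      P.-integrable [set: T] (EFin \o f) &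
      forall C, G C -> \int[P]_(w in C) (f w)%:E = P (A `&` C)]%E.

(* F1 and F2 are independent given G: P(A & B | G) = P(A | G) P(B | G) almost
   surely for all A in F1 and B in F2.  Versions exist (Radon-Nikodym) and are
   almost surely unique, so quantifying them existentially or universally is
   the same. *)
Definition cond_independent (G F1 F2 : set (set T)) : Prop :=
  forall A B, F1 A -> F2 B ->
  exists fA fB fAB : T -> R,
    [/\ cond_probability G A fA, cond_probability G B fB,
        cond_probability G (A `&` B) fAB &
        {ae P, forall w, fAB w = fA w * fB w}].

(* sigma-algebra generated by the vectors x_k, k in J; trivial if J is empty *)
Definition sigma_of n d (x : 'I_n -> T -> 'cV[R]_d) (J : set 'I_n) :
    set (set T) :=
  <<s [set A | exists k i (B : set R),
         [/\ J k, measurable B & A = (fun w => x k w i 0) @^-1` B] ]>>.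

(* The Markov property does not depend on the origin of the time interval, so
   a sequence on any interval of n integers is indexed by 'I_n. *)
Definition markov_sequence n d (x : 'I_n -> T -> 'cV[R]_d) : Prop :=
  forall k : 'I_n,
    cond_independent (sigma_of x [set k])
      (sigma_of x [set i : 'I_n | (i < k)%N])
      (sigma_of x [set i : 'I_n | (k < i)%N]).

Definition reciprocal_sequence n d (x : 'I_n -> T -> 'cV[R]_d) : Prop :=
  forall j l : 'I_n, (j < l)%N ->
    cond_independent (sigma_of x [set j; l])
      (sigma_of x [set k : 'I_n | (j < k < l)%N])
      (sigma_of x [set k : 'I_n | (k < j)%N || (l < k)%N]).

End conditional_independence.

(* Main.v *)
(** For a centered Gaussian vector [X], the characteristic functions
    [E cos (<a, X> + th) = cos th * exp (- Var <a, X> / 2)] show that orthogonal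
    spaces of linear combinations of the coordinates are independent, and hence
    that, when the coordinates are partitioned into [A], [Z], [B], those in [A]
    and [B] are conditionally independent given those in [Z] if and only if the
    [(A, B)] block of the precision matrix (the inverse covariance) vanishes.
    Thus a sequence is Markov when its precision matrix [Q] has no nonzero block
    [(i, j)] with [i < k < j], and reciprocal when [Q] has no nonzero block
    [(k, i)] with [k] inside and [i] outside some [[j, l]].  Regressing the [x_k]
    on a single [x_e] leaves residuals whose precision matrix is obtained from
    [Q] by deleting the rows and columns of [x_e].  The representations with
    [e = N] and [e = 0] with Markov residuals therefore say that the blocks
    [(i, j)] of [Q] with [i < k < j] vanish, for [j < N] and for [0 < i]
    respectively; together these are exactly the blocks that vanish for a
    reciprocal sequence. *)
Require Import Defs.
From HB Require Import structures.
From mathcomp Require Import all_boot all_order all_algebra.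
From mathcomp Require Import all_classical all_reals all_analysis.
From mathcomp Require Import measurable_realfun.
From mathcomp Require Import ring lra.

Import Order.TTheory GRing.Theory Num.Theory.
Import numFieldNormedType.Exports.

Set Implicit Arguments.
Unset Strict Implicit.
Unset Printing Implicit Defensive.

Local Open Scope classical_set_scope.
Local Open Scope ring_scope.

(** * The characteristic function of Gaussian variables *)

(** The obstacle is the gap between characteristic functions and the sigma-algebras in
    [cond_independent]. To bridge it, statements are put in the form E(W f) = 0 for a bounded weight
    W: a weight orthogonal to all cos(h + th), with h in a linear space of random variables, is
    orthogonal to every event which that space generates. Real cosines with a free phase th are
    stable under products up to linear combinations, so no complex-valued integral arises, and only
    the laws of scalar combinations enter, as in the definition of joint Gaussianity. Conditional
    independence takes this form with W = 1_B - P(B | G), once conditional probabilities are clipped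
    to [0, 1]. In the converse direction, factorization of E(cos cos) yields cosh t = 1 for a
    covariance t, whence t = 0. Conditioning on Z appears as orthogonal projection onto the span of
    the coordinates in Z, so that the conditional covariance is never written as a block matrix. *)

Section gaussian_integrals.
Context {R : realType}.
Local Notation mu := (@lebesgue_measure R).

(** The truncated integrals over [m - n, m + n] are boundary differences of F, which tend to 0; by
    dominated convergence with bound |f| they also tend to the full integral. *)
Lemma Rintegral_derivative_eq0 (F f : R -> R) (m : R) :
  (forall x : R, is_derive x (1 : R) F (f x)) -> continuous f ->
  mu.-integrable [set: R] (EFin \o f) ->
  F (m + n%:R) @[n --> \oo] --> (0 : R) ->
  F (m - n%:R) @[n --> \oo] --> (0 : R) ->
  \int[mu]_x f x = 0.
Proof.
move=> dF cf intf Fr Fl.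
pose I n : set R := `[m - n%:R, m + n%:R]%classic.
have mf : measurable_fun [set: R] f by case/integrableP : intf => /measurable_EFinP.
have FTC n : (\int[mu]_x ((f \_ (I n)) x)%:E = (F (m + n%:R) - F (m - n%:R))%:E)%E.
  transitivity (\int[mu]_(x in I n) (f x)%:E)%E.
    by rewrite [RHS]integral_mkcond restrict_EFin.
  (* The fundamental theorem of calculus is applied on a nondegenerate interval, so n = 0 is
     separate. *)
  have [->|n0] := eqVneq n 0%N.
    by rewrite /I addr0 subr0 set_itv1 integral_set1 subrr.
  rewrite (@continuous_FTC2 _ f F) ?EFinB//.
  - by rewrite ltrD2l (@lt_trans _ _ 0)// ?oppr_lt0 ltr0n lt0n.
  - exact: continuous_subspaceT.
  - split.
    + by move=> x _; exact: ex_derive.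
    + apply: cvg_at_right_filter; apply: differentiable_continuous.
      by apply/derivable1_diffP; exact: ex_derive.
    + apply: cvg_at_left_filter; apply: differentiable_continuous.
      by apply/derivable1_diffP; exact: ex_derive.
  - by move=> x _; rewrite derive1E derive_val.
have L0 : (\int[mu]_x ((f \_ (I n)) x)%:E)%E @[n --> \oo] --> (0 : R)%:E.
  under eq_fun do rewrite FTC.
  apply: cvg_EFin; first exact: nearW.
  by rewrite -(subrr (0 : R)); apply: cvgB.
have L1 : (\int[mu]_x ((f \_ (I n)) x)%:E)%E @[n --> \oo] --> (\int[mu]_x (f x)%:E)%E.
  apply: (@dominated_cvg _ _ _ mu _ measurableT
    (fun n x => ((f \_ (I n)) x)%:E) (EFin \o f) (abse \o (EFin \o f))).
  - move=> n; apply/measurable_EFinP.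
    apply/(measurable_restrictT _ _).1 => //; first exact: measurable_itv.
    exact: measurable_funTS.
  - move=> x _; apply: cvg_near_cst; near=> n.
    rewrite patchE ifT// inE /I/= in_itv/= -ler_distlC ltW//.
    near: n; exact: nbhs_infty_gtr.
  - by move=> x _.
  - exact: integrable_abse.
  - move=> n x _ /=; rewrite patchE; case: ifPn => _ //=.
    by rewrite normr0 lee_fin.
by have := cvg_unique _ L0 L1 => /(_ (@ereal_hausdorff R)); rewrite /Rintegral => <-.
Unshelve. all: by end_near. Qed.


Section normal_density.
Variables (m s : R).
Hypothesis s0 : s != 0.
Local Notation p := (normal_pdf m s).

Lemma is_derive_normal_pdf (x : R) :
  is_derive x (1 : R) p (- ((x - m) / s ^+ 2) * p x).
Proof.
rewrite normal_pdfE// /normal_fun.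
apply: is_derive_eq.
rewrite /GRing.scale/=; field; exact: s0.
Qed.

(** Half of the Gaussian exponent absorbs the square: with v = (x - m)^2 / (4 s^2), the density is a
    multiple of exp(-v)^2, and v exp(-v) <= 1. The other factor exp(-v) is a Gaussian of deviation
    sqrt 2 times s, still integrable. *)
Lemma sqr_normal_pdf_le (x : R) :
  (x - m) ^+ 2 * p x
  <= 4 * s ^+ 2 * normal_peak s * normal_fun m (Num.sqrt 2 * s) x.
Proof.
rewrite normal_pdfE//.
set v := (x - m) ^+ 2 / (4 * s ^+ 2).
have -> : normal_fun m (Num.sqrt 2 * s) x = expR (- v).
  rewrite /normal_fun exprMn sqr_sqrtr//; congr expR.
  by rewrite /v -mulr_natr; field; exact: s0.
have -> : normal_fun m s x = expR (- v) * expR (- v).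
  rewrite /normal_fun -expRD; congr expR.
  by rewrite /v -mulr_natr; field; exact: s0.
have -> : (x - m) ^+ 2 = 4 * s ^+ 2 * v by rewrite /v; field; exact: s0.
have vexp : v * expR (- v) <= 1.
  rewrite expRN ler_pdivrMr ?expR_gt0// mul1r.
  by apply: le_trans (expR_ge1Dx v); rewrite lerDr.
have K0 : 0 <= 4 * s ^+ 2 * normal_peak s * expR (- v).
  by rewrite mulr_ge0 ?expR_ge0// mulr_ge0 ?normal_peak_ge0// mulr_ge0 ?sqr_ge0.
have := ler_piMr K0 vexp; apply: le_trans; rewrite le_eqVlt; apply/orP; left; apply/eqP.
by ring.
Qed.

Lemma integrable_normal_fun (t : R) : t != 0 ->
  mu.-integrable [set: R] (EFin \o normal_fun m t).
Proof.
move=> t0.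
have -> : EFin \o normal_fun m t =
    (fun x => (normal_peak t)^-1%:E * (normal_pdf m t x)%:E)%E.
  apply/funext => x /=; rewrite normal_pdfE// -EFinM mulKf//.
  by rewrite gt_eqF// normal_peak_gt0.
by apply: integrableZl => //; exact: integrable_normal_pdf.
Qed.

Lemma integrable_normal_pdf_sqr (C : R) (f : R -> R) :
  measurable_fun [set: R] f ->
  (forall x, `|f x| <= C * (1 + (x - m) ^+ 2)) ->
  mu.-integrable [set: R] (fun x => (f x * p x)%:E).
Proof.
move=> mf fC.
have mp : measurable_fun [set: R] p by exact: measurable_normal_pdf.
have p0 x : 0 <= p x by exact: normal_pdf_ge0.
have C0 : 0 <= C.
  by have := fC m; rewrite subrr expr0n/= addr0 mulr1; exact: le_trans.
pose K := 4 * s ^+ 2 * normal_peak s.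
apply: (@le_integrable _ _ _ mu _ measurableT _
  (fun x => C%:E * ((normal_pdf m s x)%:E
     + K%:E * (normal_fun m (Num.sqrt 2 * s) x)%:E))%E).
- by apply/measurable_EFinP; exact: measurable_funM.
- move=> x _; rewrite /= lee_fin normrM (ger0_norm (p0 x)).
  apply: (le_trans (ler_wpM2r (p0 x) (fC x))); rewrite -mulrA.
  apply: le_trans (ler_norm _); apply: ler_wpM2l => //.
  by rewrite mulrDl mul1r lerD2l; exact: sqr_normal_pdf_le.
- apply: integrableZl => //; apply: integrableD => //.
  + exact: integrable_normal_pdf.
  + apply: integrableZl => //; apply: integrable_normal_fun.
    by rewrite mulf_neq0// sqrtr_eq0 -ltNge.
Qed.

(** Integration by parts, as p' = -(x - m) / s^2 p. It gives the mean (q = 1), the variance (q = x -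
    m) and the differential equation of the characteristic function (q a sine). *)
Lemma normal_Stein (q q' : R -> R) (C : R) :
  (forall x : R, is_derive x (1 : R) q (q' x)) -> continuous q' ->
  (forall x, `|q x| <= C * (1 + `|x - m|)) -> (forall x, `|q' x| <= C) ->
  s ^+ 2 * \int[mu]_x (q' x * p x) = \int[mu]_x (q x * (x - m) * p x).
Proof.
move=> dq cq' qC q'C.
have C0 : 0 <= C by exact: le_trans (q'C 0).
have cq : continuous q.
  move=> x; apply: differentiable_continuous.
  by apply/derivable1_diffP; exact: ex_derive.
have cx : continuous (fun x : R => x - m).
  by move=> x; apply: cvgB; [exact: cvg_id|exact: cvg_cst].
have mq' : measurable_fun [set: R] q' by exact: continuous_measurable_fun.
have mq : measurable_fun [set: R] (fun x => q x * (x - m)).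
  apply: measurable_funM; apply: continuous_measurable_fun; [exact: cq|exact: cx].
have abs_le (u : R) : `|u| <= 1 + u ^+ 2.
  rewrite -[u ^+ 2]real_normK ?num_real//.
  have := sqr_ge0 (`|u| - 1); nra.
have i1 : mu.-integrable [set: R] (fun x => (q' x * p x)%:E).
  apply: (@integrable_normal_pdf_sqr C) => // x.
  apply: (le_trans (q'C x)); rewrite ler_peMr// lerDl sqr_ge0//.
have i2 : mu.-integrable [set: R] (fun x => (q x * (x - m) * p x)%:E).
  apply: (@integrable_normal_pdf_sqr (2 * C)) => // x.
  rewrite normrM; apply: le_trans (ler_wpM2r (normr_ge0 _) (qC x)) _.
  rewrite -[(x - m) ^+ 2]real_normK ?num_real//.
  have := abs_le (x - m); rewrite -[(x - m) ^+ 2]real_normK ?num_real//.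
  by have := normr_ge0 (x - m); nra.
(* With u = |x - m|, |q| u <= C (u + u^2) <= C (1 + 2 u^2), while p <= [normal_peak s] and u^2 p <=
   4 s^2 [normal_peak s]. Hence q p is at most D / n at m + n and m - n. *)
pose D := C * (normal_peak s + 8 * s ^+ 2 * normal_peak s).
have qpD x : `|q x * p x| * `|x - m| <= D.
  have px0 := normal_pdf_ge0 m s x.
  have up : `|x - m| ^+ 2 * p x <= 4 * s ^+ 2 * normal_peak s.
    rewrite real_normK ?num_real//; apply: (le_trans (sqr_normal_pdf_le x)).
    apply: ler_piMr.
      by rewrite mulr_ge0 ?normal_peak_ge0// mulr_ge0 ?sqr_ge0.
    rewrite -expR0 ler_expR mulNr oppr_le0 mulr_ge0 ?sqr_ge0// invr_ge0.
    by rewrite mulrn_wge0 ?sqr_ge0.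
  rewrite normrM (ger0_norm px0).
  apply: (@le_trans _ _ (C * ((1 + 2 * `|x - m| ^+ 2) * p x))).
    rewrite mulrAC mulrA; apply: ler_wpM2r => //.
    apply: (le_trans (ler_wpM2r (normr_ge0 _) (qC x))).
    rewrite -mulrA; apply: ler_wpM2l => //.
    have := abs_le (x - m); rewrite -[(x - m) ^+ 2]real_normK ?num_real//.
    by rewrite expr2; lra.
  apply: ler_wpM2l => //.
  rewrite mulrDl mul1r lerD//; first exact: normal_pdf_ub.
  by rewrite -mulrA -!(mulrA 8); move: up; rewrite -!(mulrA 4); lra.
have cvgF (z : nat -> R) : (forall n, `|z n - m| = n%:R) ->
    q (z n) * p (z n) @[n --> \oo] --> (0 : R).
  move=> zm; apply/cvgr0Pnorm_le => e e0; near=> n.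
  have n0 : 0 < n%:R :> R by rewrite ltr0n; near: n; exact: nbhs_infty_gt.
  rewrite -(ler_pM2r n0) -{1}(zm n); apply: le_trans (qpD _) _.
  rewrite -ler_pdivrMl// mulrC.
  near: n; exact: nbhs_infty_ger.
(* This is the derivative of q p. *)
pose f x := q' x * p x - s ^- 2 * (q x * (x - m) * p x).
have s20 : s ^+ 2 != 0 by rewrite sqrf_eq0.
have cp : continuous p by exact: continuous_normal_pdf.
have intf : mu.-integrable [set: R] (EFin \o f).
  apply: (eq_integrable measurableT _ _ _
    (integrableB measurableT i1 (integrableZl measurableT (s ^- 2) i2))).
  by move=> x _ /=.
have : \int[mu]_x f x = 0.
  apply: (@Rintegral_derivative_eq0 (fun x => q x * p x) f m) => //.
  - move=> x; have dp := is_derive_normal_pdf x; have dqx := dq x.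
    apply: is_derive_eq.
    by rewrite /f /GRing.scale/=; field; exact: s0.
  - move=> x; apply: cvgB; apply: cvgM.
    + exact: cq'.
    + exact: cp.
    + exact: cvg_cst.
    + by apply: cvgM; [apply: cvgM; [exact: cq|exact: cx]|exact: cp].
  - by apply: cvgF => n; rewrite addrC addKr normr_nat.
  - by apply: cvgF => n; rewrite addrC addKr normrN normr_nat.
rewrite /f RintegralB//; last exact: (integrableZl measurableT (s ^- 2) i2).
rewrite RintegralZl// => /eqP; rewrite subr_eq0 => /eqP ->.
by rewrite mulVKf.
Unshelve. all: by end_near. Qed.


Lemma normal_pdf_mean : \int[mu]_x ((x - m) * p x) = 0.
Proof.
transitivity (\int[mu]_x (1 * (x - m) * p x)).
  by apply: eq_Rintegral => x _; rewrite mul1r.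
rewrite -(@normal_Stein (cst 1) (cst 0) 1).
- by rewrite /Rintegral integral0_eq ?mulr0// => x _; rewrite /cst mul0r.
- by move=> x; exact: cvg_cst.
- by move=> x; rewrite normr1 mul1r lerDl.
- by move=> x; rewrite normr0.
Qed.

Lemma normal_pdf_variance : \int[mu]_x ((x - m) ^+ 2 * p x) = s ^+ 2.
Proof.
transitivity (\int[mu]_x ((x - m) * (x - m) * p x)).
  by apply: eq_Rintegral => x _; rewrite expr2.
have dq (x : R) : is_derive x (1 : R) (fun x => x - m) (cst 1 x).
  by apply: is_derive_eq; rewrite subr0.
rewrite -(@normal_Stein _ _ 1 dq).
- rewrite (_ : Rintegral _ _ _ = 1) ?mulr1//.
  rewrite /Rintegral; under eq_integral do rewrite mul1r.
  by rewrite integral_normal_pdf.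
- by move=> x; exact: cvg_cst.
- by move=> x; rewrite mul1r lerDr.
- by move=> x; rewrite normr1.
Qed.

Let cos_le1 (x : R) : `|cos x| <= 1. Proof. by rewrite ler_norml cos_geN1 cos_le1. Qed.
Let sin_le1 (x : R) : `|sin x| <= 1. Proof. by rewrite ler_norml sin_geN1 sin_le1. Qed.

(** As a function of t, the integral phi satisfies phi' = - t s^2 phi: differentiate under the
    integral sign and apply [normal_Stein] to the resulting sine. So phi times exp((t s)^2 / 2) is
    constant, equal to its value cos th at t = 0. *)
Lemma normal_pdf_cos (t th : R) :
  \int[mu]_x (cos (t * (x - m) + th) * p x) = cos th * expR (- (t * s) ^+ 2 / 2).
Proof.
pose f (t x : R) := cos (t * (x - m) + th) * p x.
pose phi t := \int[mu]_x f t x.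
have carg (a : R) : continuous (fun x : R => a * (x - m) + th).
  move=> x; apply: cvgD; last exact: cvg_cst.
  by apply: cvgM; [exact: cvg_cst|apply: cvgB; [exact: cvg_id|exact: cvg_cst]].
have ccos (a : R) : continuous (fun x : R => cos (a * (x - m) + th)).
  by move=> x; apply: continuous_comp; [exact: carg|exact: continuous_cos].
have p0 x : 0 <= p x by exact: normal_pdf_ge0.
have intf a : mu.-integrable [set: R] (EFin \o f a).
  apply: (@integrable_normal_pdf_sqr 1).
  - by apply: continuous_measurable_fun; exact: ccos.
  - by move=> x; rewrite mul1r (le_trans (cos_le1 _))// lerDl sqr_ge0.
have df (a x : R) : is_derive a (1 : R) (f ^~ x) (- (sin (a * (x - m) + th) * (x - m)) * p x).
  apply: is_derive_eq.
  rewrite /GRing.scale/=; ring.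
have d1f a x : partial1of2 f a x = - (sin (a * (x - m) + th) * (x - m)) * p x.
  by rewrite partial1of2E; exact: derive_val.
pose G x := `|x - m| * p x.
have intG : mu.-integrable [set: R] (EFin \o G).
  apply: (@integrable_normal_pdf_sqr 1).
  - apply: measurableT_comp => //; exact: measurable_funB.
  - move=> x; rewrite mul1r normr_id -[(x - m) ^+ 2]real_normK ?num_real//.
    have := sqr_ge0 (`|x - m| - 1); nra.
have dphi (a : R) : is_derive a (1 : R) phi (- (a * s ^+ 2) * phi a).
  (* Any interval around a would do: the dominating function [G] does not depend on the
     parameter. *)
  have ai : `]a - 1, a + 1[%classic a by rewrite /= in_itv/= ltrBlDr ltrDl ltr01.
  have h1 : forall x : R, `]a - 1, a + 1[%classic x -> mu.-integrable [set: R] (EFin \o f x).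
    by move=> x _; exact: intf.
  have h2 : forall x y : R, `]a - 1, a + 1[%classic x -> setT y -> derivable (f ^~ y) x 1.
    by move=> x y _ _; exact: ex_derive.
  have h3 : forall x y : R, `]a - 1, a + 1[%classic x -> setT y -> `|partial1of2 f x y| <= G y.
    move=> x y _ _; rewrite d1f normrM normrN normrM (ger0_norm (p0 y)) ler_wpM2r//.
    by rewrite ler_piMl.
  have G0 y : 0 <= G y by rewrite mulr_ge0.
  apply: DeriveDef.
    exact: (derivable_under_integral measurableT ai h1 h2 G0 intG h3).
  rewrite -derive1E (differentiation_under_integral measurableT ai h1 h2 G0 intG h3).
  have dq (x : R) : is_derive x (1 : R) (fun x => sin (a * (x - m) + th))
      (a * cos (a * (x - m) + th)).
    by apply: is_derive_eq; rewrite /GRing.scale/=; ring.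
  have St := @normal_Stein _ _ (`|a| + 1) dq.
  transitivity (- \int[mu]_x (sin (a * (x - m) + th) * (x - m) * p x)).
    rewrite -mulN1r -RintegralZl//; last first.
      apply: (@integrable_normal_pdf_sqr 1).
        apply: measurable_funM; last exact: measurable_funB.
        apply: continuous_measurable_fun => y.
        by apply: continuous_comp; [exact: carg|exact: continuous_sin].
      move=> x; rewrite mul1r normrM.
      apply: (@le_trans _ _ `|x - m|); first by rewrite ler_piMl.
      rewrite -[(x - m) ^+ 2]real_normK ?num_real//.
      have := sqr_ge0 (`|x - m| - 1); nra.
    by apply: eq_Rintegral => x _; rewrite d1f mulN1r mulNr.
  rewrite -St.
  - under eq_Rintegral do rewrite -mulrA.
    rewrite RintegralZl//; last exact: intf.
    by rewrite /phi /f; ring.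
  - by move=> x; apply: cvgM; [exact: cvg_cst|exact: ccos].
  - move=> x; apply: (le_trans (sin_le1 _)); have := normr_ge0 a; have := normr_ge0 (x - m); nra.
  - move=> x; rewrite normrM; have := cos_le1 (a * (x - m) + th); have := normr_ge0 a.
    have := normr_ge0 (cos (a * (x - m) + th)); nra.
pose g (t : R) := phi t * expR ((t * s) ^+ 2 / 2).
have dg (a : R) : is_derive a (1 : R) g 0.
  have da := dphi a.
  apply: is_derive_eq.
  by rewrite /GRing.scale/=; field.
have := is_derive_0_is_cst t 0 dg.
rewrite /g mul0r expr0n/= mul0r expR0 mulr1.
have -> : phi 0 = cos th.
  rewrite /phi /f; under eq_Rintegral do rewrite mul0r add0r.
  rewrite RintegralZl//; last exact: integrable_normal_pdf.
  by rewrite /Rintegral integral_normal_pdf mulr1.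
rewrite -/(phi t) => <-; rewrite -mulrA -expRD mulNr subrr expR0 mulr1//.
Qed.

End normal_density.

End gaussian_integrals.

(** * Moments and characteristic function of a Gaussian random variable *)

Section gaussian_random_variable.
Context {R : realType}.
Local Notation mu := (@lebesgue_measure R).

Lemma integral_normal_prob (m s : R) (f : R -> \bar R) :
  measurable_fun [set: R] f ->
  (\int[normal_prob m s]_x `|f x| < +oo)%E ->
  (\int[normal_prob m s]_x f x = \int[mu]_x (f x * (normal_pdf m s x)%:E))%E.
Proof.
move=> mf finf.
have dom := normal_prob_dominates m s.
rewrite -(Radon_Nikodym_change_of_variables dom)//=; last first.
  by apply/integrableP; split.
apply: ae_eq_integral => //.
- by apply: emeasurable_funM => //; exact/(measurable_int mu)/(Radon_Nikodym_integrable dom).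
- apply: emeasurable_funM => //; apply/measurable_EFinP.
  exact: measurable_normal_pdf.
- apply: ae_eqe_mul2l => /=.
  rewrite Radon_NikodymE//=.
  case: cid => /= h [h1 h2 h3].
  apply: integral_ae_eq => //=.
  + by apply/measurable_EFinP; exact: measurable_normal_pdf.
  + by move=> E E01 mE; rewrite -h3.
Qed.

(** No finiteness is assumed here; applied to |f|, it supplies the finiteness that
    [integral_normal_prob] asks for. *)
Lemma ge0_integral_normal_prob (m s : R) (f : R -> \bar R) :
  measurable_fun [set: R] f -> (forall x, 0 <= f x)%E ->
  (\int[normal_prob m s]_x f x = \int[mu]_x (f x * (normal_pdf m s x)%:E))%E.
Proof.
move=> mf f0.
have dom := normal_prob_dominates m s.
rewrite -(Radon_Nikodym_SigmaFinite.change_of_variables dom)//=.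
apply: ae_eq_integral => //.
- apply: emeasurable_funM => //; apply: (measurable_int mu).
  exact: Radon_Nikodym_SigmaFinite.f_integrable.
- apply: emeasurable_funM => //; apply/measurable_EFinP.
  exact: measurable_normal_pdf.
- apply: ae_eqe_mul2l => /=.
  apply: integral_ae_eq => //=.
  + exact: Radon_Nikodym_SigmaFinite.f_integrable.
  + by apply/measurable_EFinP; exact: measurable_normal_pdf.
  + by move=> E E01 mE; rewrite -Radon_Nikodym_SigmaFinite.f_integral.
Qed.

Context {disp : measure_display} {T : measurableType disp}.
Variable P : probability T R.

Lemma law_expectation (nu : probability (measurableTypeR R) R) (X : T -> R)
    (f : R -> R) :
  measurable_fun [set: T] X ->
  (forall B : set R, measurable B -> P (X @^-1` B) = nu B) ->
  measurable_fun [set: R] f -> (\int[nu]_x `|(f x)%:E| < +oo)%E ->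
  P.-integrable [set: T] (fun w => (f (X w))%:E) /\
  (\int[P]_w (f (X w))%:E = \int[nu]_x (f x)%:E)%E.
Proof.
move=> mX lX mf finf.
(* [R] and [measurableTypeR R] carry convertible but distinct measurable
   structures, and the measures on [R] of the library use the latter. *)
have mX' : @measurable_fun _ _ T (measurableTypeR R) [set: T] X by exact: mX.
pose Xm : {RV P >-> measurableTypeR R} :=
  @mfun_Sub _ _ T (measurableTypeR R) X (mem_set mX').
have lawE : forall A : set (measurableTypeR R), measurable A -> A `<=` setT ->
    distribution P Xm A = nu A.
  by move=> A mA _; rewrite -lX.
have intX : P.-integrable [set: T] (fun w => (f (X w))%:E).
  apply/integrableP; split.
    by apply/measurable_EFinP; exact: measurableT_comp.
  rewrite -[X in (X < _)%E](@ge0_integral_distribution _ _ _ _ _ P Xm (fun x => `|(f x)%:E|%E))//.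
    by rewrite (eq_measure_integral nu lawE).
  by apply/measurable_EFinP; exact: measurableT_comp.
split => //.
rewrite -[LHS](@integral_distribution _ _ _ _ _ P Xm (fun x => (f x)%:E))//; last first.
  exact/measurable_EFinP.
by rewrite (eq_measure_integral nu lawE).
Qed.

Lemma gaussian_expectation (X : T -> R) (m s : R) (f : R -> R) (C : R) :
  measurable_fun [set: T] X ->
  (forall B : set R, measurable B -> P (X @^-1` B) = gaussian_law m s B) ->
  measurable_fun [set: R] f -> (forall x, `|f x| <= C * (1 + (x - m) ^+ 2)) ->
  P.-integrable [set: T] (fun w => (f (X w))%:E) /\
  \int[P]_w f (X w) =
    if s == 0 then f m else \int[mu]_x (f x * normal_pdf m s x).
Proof.
move=> mX lX mf fC.
move: lX; rewrite /gaussian_law; case: ifPn => [_|s0] lX.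
  have intd (g : R -> R) : measurable_fun [set: R] g ->
      (\int[@dirac _ (measurableTypeR R) m R]_x (g x)%:E = (g m)%:E)%E.
    by move=> mg; rewrite integral_dirac//= ?diracT ?mul1e//; exact/measurable_EFinP.
  have [|iX eX] := @law_expectation (@dirac _ (measurableTypeR R) m R) _ _ mX lX mf.
    rewrite (intd (fun x => `|f x|)) ?ltry//; exact: measurableT_comp.
  by split => //; rewrite /Rintegral eX intd.
have intf := integrable_normal_pdf_sqr s0 mf fC.
have finf : (\int[normal_prob m s]_x `|(f x)%:E| < +oo)%E.
  rewrite ge0_integral_normal_prob//; last first.
    by apply/measurable_EFinP; exact: measurableT_comp.
  move/integrableP : intf => [_]; apply: le_lt_trans.
  rewrite le_eqVlt; apply/orP; left; apply/eqP; apply: eq_integral => x _.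
  by rewrite -EFinM /= normrM (ger0_norm (normal_pdf_ge0 _ _ _)).
have [iX eX] := law_expectation mX lX mf finf.
split => //; rewrite /Rintegral eX; congr fine.
by rewrite integral_normal_prob//; exact/measurable_EFinP.
Qed.

Lemma Lfun2_sqr_integrable (f : T -> R) : measurable_fun [set: T] f ->
  P.-integrable [set: T] (fun w => (f w ^+ 2)%:E) -> f \in Lfun P 2%:E.
Proof.
move=> mf /integrableP[_ intf].
rewrite inE; apply/andP; split; rewrite inE//=.
rewrite /finite_norm unlock /Lnorm poweR_lty//.
apply: le_lt_trans intf; apply: ge0_le_integral => //=.
- apply/measurable_EFinP.
  apply/(@measurableT_comp _ _ _ _ _ _ (fun x : R => x `^ 2)%R) => //.
  exact/measurableT_comp.
- by apply/measurable_EFinP; apply: measurableT_comp => //; exact: measurable_funX.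
- by move=> x _; rewrite lee_fin normrX powR_mulrn.
Qed.

(** The parameters m and s in [gaussian] are only existential. Computing the mean identifies m with
    0 and computing the second moment identifies s^2, in the degenerate case s = 0 as well, so the
    formula mentions the moment and not s. *)
Lemma gaussian_centered (X : T -> R) : gaussian P X -> ('E_P[X] = 0)%E ->
  X \in Lfun P 2%:E /\
  forall th, \int[P]_w cos (X w + th) =
    cos th * expR (- (\int[P]_w (X w ^+ 2)) / 2).
Proof.
move=> [mX [m [s [s_ge0 lX]]]] EX.
have sq1 (u : R) : `|u| <= 1 + u ^+ 2.
  rewrite -[u ^+ 2]real_normK ?num_real//.
  have := sqr_ge0 (`|u| - 1); nra.
have intp (C : R) (f : R -> R) : s != 0 -> measurable_fun [set: R] f ->
    (forall x, `|f x| <= C * (1 + (x - m) ^+ 2)) ->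
    mu.-integrable [set: R] (fun x => (f x * normal_pdf m s x)%:E).
  by move=> s0; exact: integrable_normal_pdf_sqr.
have mid : measurable_fun [set: R] (id : R -> R) by exact: measurable_id.
have xC (x : R) : `|x| <= (1 + `|m|) * (1 + (x - m) ^+ 2).
  rewrite -{1}(subrK m x); apply: (le_trans (ler_normD _ _)).
  have := sq1 (x - m); have := normr_ge0 m; have := sqr_ge0 (x - m); nra.
have m0 : m = 0.
  have [_] := @gaussian_expectation X m s id _ mX lX mid xC.
  have -> : \int[P]_w id (X w) = 0.
    have EXE : (\int[P]_w (X w)%:E)%E = 'E_P[X]%E by rewrite unlock.
    by rewrite /Rintegral EXE EX.
  case: ifPn => [_ ->//|s0].
  rewrite (_ : Rintegral _ _ _ = m) => [->//|].
  transitivity (\int[mu]_x ((x - m) * normal_pdf m s x + m * normal_pdf m s x)).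
    by apply: eq_Rintegral => x _; rewrite -mulrDl subrK.
  rewrite RintegralD//; last 2 first.
  - apply: (intp 1) => //; first exact: measurable_funB.
    by move=> x; rewrite mul1r; exact: sq1.
  - apply: (intp `|m|) => // x; rewrite ler_peMr// lerDl sqr_ge0//.
  rewrite normal_pdf_mean// add0r RintegralZl//; last exact: integrable_normal_pdf.
  by rewrite /Rintegral integral_normal_pdf mulr1.
subst m.
have mcos (th : R) : measurable_fun [set: R] (fun x : R => cos (x + th)).
  apply: continuous_measurable_fun => x; apply: continuous_comp; last exact: continuous_cos.
  by apply: cvgD; [exact: cvg_id|exact: cvg_cst].
have msqr : measurable_fun [set: R] (fun x : R => x ^+ 2) by exact: measurable_funX.
have [isq esq] := @gaussian_expectation X 0 s (fun x => x ^+ 2) 1 mX lX msqr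
  (fun x => ltac:(rewrite mul1r subr0 ger0_norm ?sqr_ge0// lerDr//)).
split; first exact: Lfun2_sqr_integrable.
move=> th; rewrite esq.
have [_ ->] := @gaussian_expectation X 0 s (fun x => cos (x + th)) 1 mX lX (mcos th)
  (fun x => ltac:(rewrite mul1r (@le_trans _ _ 1)// ?lerDl ?sqr_ge0//
    ler_norml cos_geN1 cos_le1//)).
case: ifPn => [_|s0].
  by rewrite add0r expr0n/= oppr0 mul0r expR0 mulr1.
have := normal_pdf_variance 0 s0.
under eq_Rintegral do rewrite subr0.
move=> ->.
have := normal_pdf_cos 0 s0 1 th.
under eq_Rintegral do rewrite mul1r subr0.
by move=> ->; rewrite mul1r.
Qed.

End gaussian_random_variable.

(** * Uniqueness from trigonometric moments *)

Section bounded_functions.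
Context {disp : measure_display} {T : measurableType disp} {R : realType}.
Variable P : probability T R.
Implicit Types (f g W : T -> R) (A : set T).

Definition bounded_measurable f :=
  measurable_fun [set: T] f /\ exists M, forall w, `|f w| <= M.

Lemma bounded_measurable_integrable f :
  bounded_measurable f -> P.-integrable [set: T] (EFin \o f).
Proof.
move=> [mf [M fM]]; apply: measurable_bounded_integrable => //.
  by rewrite ltey_eq fin_num_measure.
by exists M; split; [exact: num_real|move=> x Mx w _; apply: le_trans (fM w) (ltW Mx)].
Qed.

Lemma bounded_measurable_cst (c : R) : bounded_measurable (cst c).
Proof. by split; [exact: measurable_cst|exists `|c|]. Qed.

Lemma bounded_measurableD f g :
  bounded_measurable f -> bounded_measurable g -> bounded_measurable (f \+ g).
Proof.
move=> [mf [M fM]] [mg [N gN]]; split; first exact: measurable_funD.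
by exists (M + N) => w; rewrite (le_trans (ler_normD _ _))// lerD.
Qed.

Lemma bounded_measurableM f g :
  bounded_measurable f -> bounded_measurable g -> bounded_measurable (f \* g).
Proof.
move=> [mf [M fM]] [mg [N gN]]; split; first exact: measurable_funM.
by exists (M * N) => w; rewrite normrM ler_pM.
Qed.

Lemma bounded_measurableB f g :
  bounded_measurable f -> bounded_measurable g -> bounded_measurable (f \- g).
Proof.
move=> bf bg; have -> : f \- g = f \+ (cst (-1) \* g).
  by apply/funext => w /=; rewrite mulN1r.
apply: bounded_measurableD => //; apply: bounded_measurableM => //.
exact: bounded_measurable_cst.
Qed.

Lemma bounded_measurable_indic A : measurable A -> bounded_measurable (\1_A : T -> R).
Proof.
move=> mA; split; first exact: measurable_indic.
by exists 1 => w; rewrite indicE; case: (w \in A); rewrite ?normr1 ?normr0.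
Qed.

Lemma bounded_measurable_cos f (th : R) : measurable_fun [set: T] f ->
  bounded_measurable (fun w => cos (f w + th)).
Proof.
move=> mf; split; last by exists 1 => w; rewrite ler_norml cos_geN1 cos_le1.
apply: (@measurableT_comp _ _ _ _ _ _ (fun x : R => cos (x + th))) => //.
apply: continuous_measurable_fun => x; apply: continuous_comp; last exact: continuous_cos.
by apply: cvgD; [exact: cvg_id|exact: cvg_cst].
Qed.

Lemma bounded_measurable_lim (f_ : nat -> T -> R) f (M : R) :
  (forall n, measurable_fun [set: T] (f_ n)) -> (forall n w, `|f_ n w| <= M) ->
  (forall w, f_ n w @[n --> \oo] --> f w) -> bounded_measurable f.
Proof.
move=> mf fM cf; split.
  by apply: (@measurable_fun_cvg _ _ _ _ f_).
exists M => w.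
have cn : `|f_ n w| @[n --> \oo] --> `|f w| by apply: cvg_norm; exact: cf.
rewrite -(cvg_lim _ cn)//; apply: limr_le; first by apply/cvg_ex; exists `|f w|.
by apply: nearW => n.
Qed.

Lemma cvg_Rintegral_bounded W (f_ : nat -> T -> R) f (M : R) :
  bounded_measurable W ->
  (forall n, measurable_fun [set: T] (f_ n)) -> (forall n w, `|f_ n w| <= M) ->
  (forall w, f_ n w @[n --> \oo] --> f w) ->
  \int[P]_w (W w * f_ n w) @[n --> \oo] --> \int[P]_w (W w * f w).
Proof.
move=> [mW [N WN]] mf fM cf.
have [mfl _] := bounded_measurable_lim mf fM cf.
apply: fine_cvg; rewrite fineK; last first.
  apply: integrable_fin_num => //; apply: bounded_measurable_integrable.
  apply: bounded_measurableM; first by split => //; exists N.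
  exact: (bounded_measurable_lim mf fM cf).
apply: (@dominated_cvg _ _ _ P _ measurableT
   (fun n w => (W w * f_ n w)%:E) _ (cst (N * M)%:E)) => //.
- by move=> n; apply/measurable_EFinP; exact: measurable_funM.
- move=> w _; apply: cvg_EFin; first exact: nearW.
  by apply: cvgM; [exact: cvg_cst|exact: cf].
- exact: finite_measure_integrable_cst.
- by move=> n w _; rewrite lee_fin normrM ler_pM.
Qed.

End bounded_functions.

(** * The sign function as a limit of polynomials *)

Section sign_approximation.
Context {R : realType}.

(** The Newton-Schulz iteration for the sign: an odd cubic fixing -1, 0 and 1, with derivative 0 at
    -1 and 1. Being polynomial, it preserves any algebra of functions. *)
Definition sign_step (x : R) : R := (3 * x - x ^+ 3) / 2.

Lemma sign_step_itv (x : R) : `|x| <= 1 -> `|sign_step x| <= 1.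
Proof.
rewrite !ler_norml /sign_step => /andP[x0 x1].
have h1 : 0 <= (1 - x) ^+ 2 * (2 + x) by apply: mulr_ge0; [exact: sqr_ge0|lra].
have h2 : 0 <= (1 + x) ^+ 2 * (2 - x) by apply: mulr_ge0; [exact: sqr_ge0|lra].
apply/andP; split.
- have -> : (3 * x - x ^+ 3) / 2 = -1 + (1 + x) ^+ 2 * (2 - x) / 2 by field.
  by rewrite lerDl divr_ge0.
- have -> : (3 * x - x ^+ 3) / 2 = 1 - (1 - x) ^+ 2 * (2 + x) / 2 by field.
  by rewrite gerBl divr_ge0.
Qed.

Lemma iter_sign_step_itv (x : R) n : `|x| <= 1 -> `|iter n sign_step x| <= 1.
Proof. by move=> x1; elim: n => //= n; exact: sign_step_itv. Qed.

Lemma iter_sign_stepN (x : R) n : iter n sign_step (- x) = - iter n sign_step x.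
Proof. by elim: n => //= n ->; rewrite /sign_step; field. Qed.

Lemma cvg_iter_sign_step (x : R) : `|x| <= 1 ->
  iter n sign_step x @[n --> \oo] --> Num.sg x.
Proof.
wlog x0 : x / 0 <= x => [hw x1|].
  have [/hw|xlt0] := leP 0 x; first exact.
  have := hw (- x); rewrite oppr_ge0 normrN => /(_ (ltW xlt0) x1).
  move=> /(@cvgN _ R^o); rewrite sgrN opprK; apply: cvg_trans.
  apply: near_eq_cvg; apply: nearW => n /=; rewrite !fctE iter_sign_stepN opprK//.
move: x0; rewrite le_eqVlt => /predU1P[<- _|x0 x1].
  rewrite sgr0; under eq_fun => n.
    rewrite (_ : iter n sign_step 0 = 0); last first.
      by elim: n => //= n ->; rewrite /sign_step expr0n/= mulr0 subr0 mul0r.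
    over.
  exact: cvg_cst.
have {}x1 : x <= 1 by move: x1; rewrite (gtr0_norm x0).
rewrite gtr0_sg//.
(* One step multiplies the error 1 - y by (1 - y)(2 + y) / 2 = 1 - y / 2 - y^2 / 2, which is at most
   r because the iterates never fall below the starting point x. *)
pose r := 1 - x / 2.
have xn n : x <= iter n sign_step x <= 1 /\ 1 - iter n sign_step x <= r ^+ n.
  elim: n => [|n [/andP[xl xu] IH]] /=.
    by rewrite lexx x1 expr0; split => //; lra.
  set y := iter n sign_step x in xl xu IH *.
  have e : 1 - sign_step y = (1 - y) * ((1 - y) * (2 + y) / 2).
    by rewrite /sign_step; field.
  have le1 : (1 - y) * (2 + y) / 2 <= r by rewrite /r; nra.
  have ge0 : 0 <= (1 - y) * (2 + y) / 2 by rewrite divr_ge0// mulr_ge0//; lra.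
  have r1 : r <= 1 by rewrite /r; lra.
  split.
    apply/andP; split; last first.
      by rewrite -subr_ge0 e mulr_ge0// subr_ge0.
    suff : 1 - sign_step y <= 1 - y by lra.
    by rewrite e ler_piMr ?subr_ge0// (le_trans le1).
  by rewrite e exprSr ler_pM// subr_ge0.
have r01 : `|r| < 1 by rewrite /r ltr_norml; apply/andP; split; lra.
suff : 1 - iter n sign_step x @[n --> \oo] --> (0 : R).
  move=> /(@cvgB _ R^o _ _ _ _ _ _ _ (cvg_cst (1 : R))).
  rewrite subr0; apply: cvg_trans; apply: near_eq_cvg; apply: nearW => n /=.
  by rewrite !fctE subKr.
apply: (@squeeze_cvgr _ _ _ _ (cst 0) (fun n => r ^+ n)).
- by apply: nearW => n; have [/andP[_ xu] ->] := xn n; rewrite subr_ge0 xu.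
- exact: cvg_cst.
- exact: cvg_expr.
Qed.

(** Once |u| < n + 1, the argument lies in (-1, 1), where sine has the sign of its argument. This
    replaces an unbounded variable by bounded trigonometric functions of its multiples. *)
Lemma cvg_sg_sin (u : R) : Num.sg (sin (n.+1%:R^-1 * u)) @[n --> \oo] --> Num.sg u.
Proof.
apply: cvg_near_cst; near=> n.
have sn0 : 0 < n.+1%:R^-1 :> R by rewrite invr_gt0.
have sgp (v : R) : 0 < v -> n.+1%:R^-1 * v < 1 -> 0 < sin (n.+1%:R^-1 * v).
  move=> v0 v1; apply: sin_gt0_pi; rewrite mulr_gt0//=.
  by apply: (lt_trans v1); apply: lt_le_trans (pi_ge2 R); rewrite ltr1n.
have un : n.+1%:R^-1 * `|u| < 1.
  rewrite mulrC ltr_pdivrMr ?ltr0n// mul1r (@lt_trans _ _ n%:R) ?ltr_nat//.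
  near: n; exact: nbhs_infty_gtr.
have [u0|u0|->] := ltgtP u 0.
- rewrite (ltr0_sg u0) -(opprK u) mulrN sinN sgrN gtr0_sg// sgp ?oppr_gt0//.
  by move: un; rewrite ltr0_norm.
- by rewrite !gtr0_sg// sgp//; move: un; rewrite gtr0_norm.
- by rewrite mulr0 sin0.
Unshelve. all: by end_near. Qed.

End sign_approximation.

(** * From trigonometric test functions to generated events *)

Section trigonometric_uniqueness.
Context {disp : measure_display} {T : measurableType disp} {R : realType}.
Variable P : probability T R.

Definition linear_family (L : set (T -> R)) :=
  [/\ L (cst 0), (forall f g, L f -> L g -> L (f \+ g)),
      (forall (c : R) f, L f -> L (fun w => c * f w)) &
      (forall f, L f -> measurable_fun [set: T] f)].

Variables (L : set (T -> R)) (W : T -> R).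
Hypotheses (linL : linear_family L) (bW : bounded_measurable W).
Hypothesis W_cos : forall f th, L f -> \int[P]_w (W w * cos (f w + th)) = 0.

Let K (f : T -> R) := bounded_measurable f /\
  forall h th, L h -> \int[P]_w (W w * (f w * cos (h w + th))) = 0.

(** [K] is only a vector space; its multipliers are closed under products too. *)
Let M (g : T -> R) := bounded_measurable g /\ forall f, K f -> K (f \* g).

Let intW (f : T -> R) : bounded_measurable f -> P.-integrable [set: T] (fun w => (W w * f w)%:E).
Proof.
move=> bf; exact/bounded_measurable_integrable/bounded_measurableM.
Qed.

Let Lmeas f : L f -> measurable_fun [set: T] f. Proof. by case: linL => _ _ _; exact. Qed.

Let KD f g : K f -> K g -> K (f \+ g).
Proof.
move=> [bf Kf] [bg Kg]; split; first exact: bounded_measurableD.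
move=> h th Lh; have bc := bounded_measurable_cos th (Lmeas Lh).
transitivity (\int[P]_w (W w * (f w * cos (h w + th)) + W w * (g w * cos (h w + th)))).
  by apply: eq_Rintegral => w _ /=; ring.
rewrite RintegralD//; last 2 first.
- by apply: intW; exact: bounded_measurableM.
- by apply: intW; exact: bounded_measurableM.
by rewrite Kf// Kg// addr0.
Qed.

Let KZ (c : R) f : K f -> K (fun w => c * f w).
Proof.
move=> [bf Kf]; split.
  by apply: bounded_measurableM => //; exact: bounded_measurable_cst.
move=> h th Lh; have bc := bounded_measurable_cos th (Lmeas Lh).
transitivity (\int[P]_w (c * (W w * (f w * cos (h w + th))))).
  by apply: eq_Rintegral => w _ /=; ring.
rewrite RintegralZl// ?Kf// ?mulr0//.
by apply: intW; exact: bounded_measurableM.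
Qed.

Let M_cst c : M (cst c).
Proof.
split; first exact: bounded_measurable_cst.
move=> f Kf; rewrite (_ : f \* cst c = (fun w => c * f w)); first exact: KZ.
by apply/funext => w /=; rewrite mulrC.
Qed.

Let MD f g : M f -> M g -> M (f \+ g).
Proof.
move=> [bf Mf] [bg Mg]; split; first exact: bounded_measurableD.
move=> h Kh; rewrite (_ : h \* _ = (h \* f) \+ (h \* g)).
  by apply: KD; [exact: Mf|exact: Mg].
by apply/funext => w /=; rewrite mulrDr.
Qed.

Let MM f g : M f -> M g -> M (f \* g).
Proof.
move=> [bf Mf] [bg Mg]; split; first exact: bounded_measurableM.
move=> h Kh; rewrite (_ : h \* _ = (h \* f) \* g).
  by apply: Mg; exact: Mf.
by apply/funext => w /=; rewrite mulrA.
Qed.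

Let M_lim (f_ : nat -> T -> R) f (B : R) : (forall n, M (f_ n)) ->
  (forall n w, `|f_ n w| <= B) -> (forall w, f_ n w @[n --> \oo] --> f w) -> M f.
Proof.
move=> Mf fB cf.
have mf n : measurable_fun [set: T] (f_ n) by case: (Mf n) => -[].
have bf : bounded_measurable f by exact: bounded_measurable_lim mf fB cf.
split => // g [bg Kg]; split; first exact: bounded_measurableM.
move=> h th Lh; have bc := bounded_measurable_cos th (Lmeas Lh).
have bWg : bounded_measurable (fun w => W w * (g w * cos (h w + th))).
  by apply: bounded_measurableM => //; exact: bounded_measurableM.
have c0 := @cvg_Rintegral_bounded _ _ _ P _ _ _ _ bWg mf fB cf.
have e0 : (fun n => \int[P]_w (W w * (g w * cos (h w + th)) * f_ n w)) = cst 0.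
  apply/funext => n.
  have [_ /(_ g (conj bg Kg))[_ /(_ h th Lh)/= <-]] := Mf n.
  by apply: eq_Rintegral => w _ /=; ring.
rewrite e0 in c0.
transitivity (\int[P]_w (W w * (g w * cos (h w + th)) * f w)).
  by apply: eq_Rintegral => w _ /=; ring.
exact: (cvg_unique _ c0 (cvg_cst (0 : R))).
Qed.

(** The product cos(h + th) cos(g + ph) is half the sum of the cosines of (h + g) + (th + ph) and (h
    - g) + (th - ph), and [L] contains h + g and h - g. *)
Let M_cos h th : L h -> M (fun w => cos (h w + th)).
Proof.
move=> Lh; have bh := bounded_measurable_cos th (Lmeas Lh).
split => // f [bf Kf]; split; first exact: bounded_measurableM.
case: linL => _ LD LZ _.
move=> g ph Lg.
have LN : L (fun w => -1 * g w) by exact: LZ.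
have b1 := bounded_measurable_cos (th + ph) (Lmeas (LD _ _ Lh Lg)).
have b2 := bounded_measurable_cos (th - ph) (Lmeas (LD _ _ Lh LN)).
transitivity (\int[P]_w (2^-1 * (W w * (f w * cos ((h \+ g) w + (th + ph))))
   + 2^-1 * (W w * (f w * cos ((h \+ (fun w => -1 * g w)) w + (th - ph)))))).
  apply: eq_Rintegral => w _ /=.
  have -> : h w + g w + (th + ph) = (h w + th) + (g w + ph) by ring.
  have -> : h w + -1 * g w + (th - ph) = (h w + th) - (g w + ph) by ring.
  by move: (h w + th) (g w + ph) => a b; rewrite cosD cosB; field.
have i1 := intW (bounded_measurableM bf b1).
have i2 := intW (bounded_measurableM bf b2).
rewrite RintegralD//; last 2 first.
- exact: (integrableZl measurableT (2^-1) i1).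
- exact: (integrableZl measurableT (2^-1) i2).
by rewrite !RintegralZl// Kf ?Kf ?mulr0 ?addr0//; exact: LD.
Qed.

Let M_sg h c : L h -> M (fun w => Num.sg (h w - c)).
Proof.
move=> Lh; case: (linL) => _ _ LZ _.
pose S n w := sin (n.+1%:R^-1 * (h w - c)).
have S1 n w : `|S n w| <= 1 by rewrite ler_norml sin_geN1 sin_le1.
have MS n : M (S n).
  have -> : S n = (fun w => cos (n.+1%:R^-1 * h w + (- (n.+1%:R^-1 * c) - pi / 2))).
    apply/funext => w; rewrite addrA -mulrBr /S.
    by rewrite cosB cos_pihalf sin_pihalf mulr0 add0r mulr1.
  by apply: M_cos; exact: LZ.
have Mstep (f : T -> R) : M f -> M (fun w => sign_step (f w)).
  move=> Mf; rewrite (_ : (fun w => _) =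
    (cst (3 / 2) \* f) \+ (cst (- 2^-1) \* (f \* (f \* f)))).
    by apply: MD; apply: MM => //; apply: MM => //; exact: MM.
  by apply/funext => w /=; rewrite /sign_step; field.
(* Two successive bounded limits: for fixed n the iterates of [sign_step] turn [S n] into its sign,
   then n tends to infinity. *)
apply: (@M_lim (fun n w => Num.sg (S n w)) _ 1).
- move=> n; apply: (@M_lim (fun k w => iter k sign_step (S n w)) _ 1).
  + by elim=> [|k IH]; [exact: MS|exact: (Mstep (fun w => iter k sign_step (S n w)))].
  + by move=> k w; exact: iter_sign_step_itv.
  + by move=> w; exact: cvg_iter_sign_step.
- by move=> n w; rewrite normr_sg; case: (_ != 0).
- by move=> w; exact: cvg_sg_sin.
Qed.

Let sigma_M : sigma_algebra [set: T] [set A | M (\1_A : T -> R)].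
Proof.
have MU A B : M (\1_A : T -> R) -> M (\1_B : T -> R) -> M (\1_(A `|` B) : T -> R).
  move=> MA MB; rewrite (_ : \1_(A `|` B) =
    (\1_A : T -> R) \+ \1_B \+ (cst (-1) \* ((\1_A : T -> R) \* \1_B))).
    by apply: MD; [exact: MD|apply: MM => //; exact: MM].
  apply/funext => w /=; rewrite !indicE in_setU.
  by case: (w \in A); case: (w \in B) => /=; ring.
split => /=.
- by rewrite indic0; exact: M_cst.
- move=> A MA; rewrite (_ : \1_(_ `\` A) = cst 1 \+ (cst (-1) \* (\1_A : T -> R))).
    by apply: MD => //; exact: MM.
  apply/funext => w /=; rewrite !indicE in_setD in_setT.
  by case: (w \in A) => /=; ring.
- move=> A MA.
  apply: (@M_lim (fun n => \1_(\big[setU/set0]_(i < n) A i)) _ 1).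
  + elim=> [|n IH]; first by rewrite big_ord0 indic0; exact: M_cst.
    by rewrite big_ord_recr/=; exact: MU.
  + by move=> n w; rewrite indicE; case: (_ \in _); rewrite ?normr1 ?normr0.
  + move=> w; apply: cvg_near_cst.
    have [/set_mem[k _ Akw]|wA] := boolP (w \in \bigcup_k A k).
      near=> n; rewrite !indicE; congr (nat_of_bool _)%:R.
      rewrite (mem_set (ex_intro2 _ _ k I Akw : (\bigcup_k A k) w)).
      rewrite mem_set// -bigcup_mkord; exists k => //=.
      near: n; exact: nbhs_infty_gt.
    near=> n; rewrite !indicE (negbTE wA) memNset// -bigcup_mkord => -[k _ Akw].
    by move/negP: wA; apply; rewrite inE; exists k.
Unshelve. all: by end_near. Qed.

Let M_preimage h (B : set R) : L h -> measurable B -> M (\1_(h @^-1` B) : T -> R).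
Proof.
move=> Lh mB.
have sB : (@RGenOInfty.G R).-sigma.-measurable B.
  by rewrite -RGenOInfty.measurableE.
have sgma : sigma_algebra [set: R] [set B | M (\1_(h @^-1` B) : T -> R)].
  have [s0 sD sU] := sigma_M; split => /=.
  - by rewrite preimage_set0.
  - move=> A /sD; rewrite !setTD preimage_setC//.
  - by move=> A MA; rewrite preimage_bigcup; exact: sU.
apply: (smallest_sub sgma _ sB) => _ [c ->] /=.
(* For a sign s equal to 1, 0, -1, the value s (s + 1) / 2 is 1, 0, 0: the indicator of the open
   ray, correct at the endpoint as well. *)
rewrite (_ : \1_ _ = (cst (2^-1) \* ((fun w => Num.sg (h w - c)) \*
    ((fun w => Num.sg (h w - c)) \+ cst 1)))).
  by apply: MM => //; apply: MM; [exact: M_sg|apply: MD => //; exact: M_sg].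
apply/funext => w /=; rewrite indicE.
have [hc|hc|hc] := ltgtP (h w) c.
- rewrite memNset/=; last by rewrite in_itv/= andbT; apply/negP; rewrite -leNgt ltW.
  by rewrite ltr0_sg ?subr_lt0// addNr !mulr0.
- rewrite mem_set/=; last by rewrite in_itv/= andbT.
  by rewrite gtr0_sg ?subr_gt0//; field.
- rewrite memNset/=; last by rewrite in_itv/= andbT hc ltxx.
  by rewrite hc subrr sgr0 mul0r mulr0.
Qed.

(* Multipliers of the class of bounded [f] with [E(W f cos(h + th)) = 0] for
   all [h] in [L] and all [th] form an algebra closed under bounded pointwise
   limits; it contains [cos(h + th)], hence signs of [h - c], hence indicators. *)
Lemma trigonometric_uniqueness (A : set T) :
  <<s [set A | exists h (B : set R), [/\ L h, measurable B & A = h @^-1` B] ]>> A ->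
  \int[P]_w (W w * \1_A w) = 0.
Proof.
move=> sA.
have [_ MA] : M (\1_A : T -> R).
  by apply: (smallest_sub sigma_M _ sA) => _ [h [B [Lh mB ->]]]; exact: M_preimage.
have K1 : K (cst 1).
  split; first exact: bounded_measurable_cst.
  move=> h th Lh; rewrite -[RHS](W_cos th Lh).
  by apply: eq_Rintegral => w _; rewrite /cst mul1r.
have [_ KA] := MA _ K1.
case: (linL) => L0 _ _ _; rewrite -[RHS](KA _ 0 L0).
by apply: eq_Rintegral => w _ /=; rewrite /cst addr0 cos0 mul1r mulr1.
Qed.

End trigonometric_uniqueness.

(** * Conditional independence *)

Section conditioning.
Context {disp : measure_display} {T : measurableType disp} {R : realType}.
Variable P : probability T R.
Implicit Types (f g W : T -> R) (A B C : set T) (G : set (set T)).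

Definition measurable_wrt G f := forall B : set R, measurable B -> G (f @^-1` B).

Definition sub_sigma_algebra_of_measurable G :=
  sigma_algebra [set: T] G /\ (forall A, G A -> measurable A).

Lemma measurable_wrt_measurable G f :
  sub_sigma_algebra_of_measurable G -> measurable_wrt G f -> measurable_fun [set: T] f.
Proof. by move=> [_ Gm] mf _ B mB; rewrite setTI; apply: Gm; exact: mf. Qed.

(** The sum counts the positive integers up to (n + 1) x, so it is the integer part of (n + 1) x.
    For x = h(w) this approximates h uniformly by combinations of indicators of level sets. *)
Lemma sum_threshold (x : R) n : 0 <= x <= 1 ->
  `|n.+1%:R^-1 * (\sum_(k < n.+1) (k.+1%:R <= n.+1%:R * x)%R%:R) - x| <= n.+1%:R^-1.
Proof.
move=> /andP[x0 x1].
have n0 : 0 < n.+1%:R :> R by rewrite ltr0n.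
set y := n.+1%:R * x.
have y0 : 0 <= y by rewrite mulr_ge0// ltW.
have yn : (Num.truncn y <= n.+1)%N.
  rewrite -(ler_nat R); apply: (@le_trans _ _ y); first by rewrite truncn_le.
  by rewrite /y ler_piMr// ltW.
have -> : \sum_(k < n.+1) (k.+1%:R <= y)%R%:R = (Num.truncn y)%:R :> R.
  rewrite -natr_sum; congr _%:R.
  rewrite (eq_bigr (fun k : 'I_n.+1 => (k < Num.truncn y)%N : nat)); last first.
    by move=> k _; rewrite truncn_ge_nat.
  by rewrite -big_mkcond/= -(big_ord_widen n.+1 (fun=> 1%N) yn) sum1_card card_ord.
have -> : n.+1%:R^-1 * (Num.truncn y)%:R - x = n.+1%:R^-1 * ((Num.truncn y)%:R - y).
  by rewrite mulrBr /y mulKf// gt_eqF.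
rewrite normrM ger0_norm ?invr_ge0 ?(ltW n0)// ler_piMr ?invr_ge0 ?(ltW n0)//.
have /andP[t1 t2] := truncn_itv y0.
rewrite distrC ger0_norm ?subr_ge0//; move: t2; rewrite -natr1; lra.
Qed.

Lemma Rintegral_mul_measurable_wrt G W g :
  sub_sigma_algebra_of_measurable G -> bounded_measurable W ->
  (forall C, G C -> \int[P]_w (W w * \1_C w) = 0) ->
  measurable_wrt G g -> bounded_measurable g ->
  \int[P]_w (W w * g w) = 0.
Proof.
move=> sG bW WC mg [_ [M0 gM0]].
pose M := `|M0| + 1.
have M_gt0 : 0 < M by rewrite ltr_wpDl.
have gM w : `|g w| <= M.
  by rewrite (le_trans (gM0 w))// (le_trans (ler_norm _))// lerDl.
have mgT := measurable_wrt_measurable sG mg.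
pose Z f := bounded_measurable f /\ \int[P]_w (W w * f w) = 0.
have intW f : bounded_measurable f -> P.-integrable [set: T] (fun w => (W w * f w)%:E).
  by move=> bf; exact/bounded_measurable_integrable/bounded_measurableM.
have ZD f h : Z f -> Z h -> Z (f \+ h).
  move=> [bf f0] [bh h0]; split; first exact: bounded_measurableD.
  under eq_Rintegral do rewrite /= mulrDr.
  by rewrite RintegralD ?f0 ?h0 ?addr0//; exact: intW.
have ZZ (c : R) f : Z f -> Z (fun w => c * f w).
  move=> [bf f0]; split.
    by apply: bounded_measurableM => //; exact: bounded_measurable_cst.
  under eq_Rintegral do rewrite mulrCA.
  by rewrite RintegralZl ?f0 ?mulr0//; exact: intW.
have [[G0 GD GU] Gm] := sG.
have Z1 C : G C -> Z (\1_C).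
  by move=> GC; split; [exact/bounded_measurable_indic/Gm|exact: WC].
have Zc (c : R) : Z (cst c).
  have GT : G setT by rewrite -(setD0 setT); exact: GD.
  rewrite (_ : cst c = (fun w => c * \1_setT w)); first by apply: ZZ; exact: Z1.
  by apply/funext => w; rewrite indicT mulr1.
(* Rescaling g into [0, 1]; [M] was made positive for this division. The thresholds on h are level
   sets of g, hence members of G. *)
pose h w := (g w + M) / (2 * M).
have h01 w : 0 <= h w <= 1.
  have := gM w; rewrite ler_norml => /andP[l u].
  have M2 : 0 < 2 * M by rewrite mulr_gt0.
  by rewrite /h ler_pdivrMr// mul1r divr_ge0 ?(ltW M2)//=; lra.
pose h_ n w := n.+1%:R^-1 * (\sum_(k < n.+1) (k.+1%:R <= n.+1%:R * h w)%R%:R) : R.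
have Zh n : Z (h_ n).
  apply: (ZZ _ (fun w => \sum_(k < n.+1) (k.+1%:R <= n.+1%:R * h w)%R%:R)).
  have -> : (fun w => \sum_(k < n.+1) (k.+1%:R <= n.+1%:R * h w)%R%:R) =
      \sum_(k < n.+1) (\1_(g @^-1` `[2 * M * (k.+1%:R / n.+1%:R) - M, +oo[) : T -> R).
    apply/funext => w; rewrite fct_sumE; apply: eq_bigr => k _.
    rewrite indicE; congr (nat_of_bool _)%:R.
    have M2 : 0 < 2 * M by rewrite mulr_gt0.
    have n0 : 0 < n.+1%:R :> R by rewrite ltr0n.
    apply/idP/idP => [le1|/set_mem/=].
      apply: mem_set => /=; rewrite in_itv/= andbT lerBlDr mulrC -ler_pdivlMr//.
      by rewrite ler_pdivrMr// mulrC.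
    by rewrite in_itv/= andbT lerBlDr mulrC -ler_pdivlMr// ler_pdivrMr// mulrC.
  elim/big_ind : _ => [|f1 f2 Z1' Z2|k _].
  - exact: (Zc 0).
  - exact: ZD.
  - by apply: Z1; apply: mg; exact: measurable_itv.
have hc w : h_ n w @[n --> \oo] --> h w.
  apply/cvgrPdist_le => e e0; near=> n.
  rewrite distrC; apply: (le_trans (sum_threshold n (h01 w))).
  rewrite invf_ple ?posrE// (@le_trans _ _ n%:R) ?ler_nat//.
  near: n; exact: nbhs_infty_ger.
have h1 n w : `|h_ n w| <= 1 + 1.
  rewrite -(subrK (h w) (h_ n w)) (le_trans (ler_normD _ _))// lerD//.
    by rewrite (le_trans (sum_threshold n (h01 w)))// invf_ple ?posrE// invr1 ler1n.
  by have /andP[l u] := h01 w; rewrite ger0_norm.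
have mh n : measurable_fun [set: T] (h_ n) by case: (Zh n) => -[].
have := @cvg_Rintegral_bounded _ _ _ P _ _ _ _ bW mh h1 hc.
have -> : (fun n => \int[P]_w (W w * h_ n w)) = cst 0.
  by apply/funext => n; case: (Zh n).
move=> /(cvg_unique _ (cvg_cst (0 : R))) h0.
have Zhh : Z h by split; [exact: bounded_measurable_lim mh h1 hc|rewrite -h0].
have [_ <-] := ZD _ _ (ZZ (2 * M) _ Zhh) (Zc (- M)).
apply: eq_Rintegral => w _ /=; congr (_ * _).
by rewrite /h /cst; field; rewrite gt_eqF.
Unshelve. all: by end_near. Qed.

End conditioning.

(** * Existence of conditional probabilities *)

Section conditional_probability_existence.
Context {disp : measure_display} {T : measurableType disp} {R : realType}.
Variables (P : probability T R) (gen : set (set T)).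
Hypothesis gen_measurable : gen `<=` measurable.

Lemma g_sigma_sub_measurable (A : set T) : <<s gen >> A -> measurable A.
Proof.
apply: smallest_sub => //; split; first exact: measurable0.
- by move=> B mB; apply: measurableD.
- by move=> F mF; apply: bigcupT_measurable.
Qed.

Let idg : T -> g_sigma_algebraType gen := fun w => w.

Let midg : measurable_fun [set: T] idg.
Proof. by move=> _ B mB; rewrite setTI; exact: g_sigma_sub_measurable. Qed.

Variables (A : set T) (mA : measurable A).

Let nu := pushforward (mrestr P mA) idg.

Let nuE B : nu B = P (B `&` A). Proof. by []. Qed.

Let nu0 : nu set0 = 0%E. Proof. exact: measure0. Qed.

Let nu_ge0 B : (0 <= nu B)%E. Proof. exact: measure_ge0. Qed.

Let nu_sigma : semi_sigma_additive nu.
Proof.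
move=> F mF tF mUF; apply: (@measure_semi_sigma_additive _ _ _ (mrestr P mA)) => //.
- by move=> n; apply: g_sigma_sub_measurable; exact: mF.
- by apply: g_sigma_sub_measurable.
Qed.

HB.instance Definition _ := isMeasure.Build _ _ _ nu nu0 nu_ge0 nu_sigma.

Let nu_fin : fin_num_fun nu.
Proof.
move=> B mB; rewrite nuE fin_num_measure//; apply: measurableI => //.
exact: g_sigma_sub_measurable.
Qed.

HB.instance Definition _ := @Measure_isFinite.Build _ _ _ nu nu_fin.

Let idgm : {mfun T >-> g_sigma_algebraType gen} := mfun_Sub (mem_set midg).

(** [idg] is the identity onto T with the smaller sigma-algebra. Pushing P and P(. & A) forward
    along it restricts both to that sigma-algebra, so their Radon-Nikodym derivative is measurable
    for it by construction. *)
Lemma cond_probability_Radon_Nikodym : exists f : T -> R,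
  cond_probability P <<s gen >> A f.
Proof.
pose mu := distribution P idgm.
have dom : nu `<< mu.
  apply/null_content_dominatesP => B mB muB0; apply/eqP.
  rewrite -measure_le0 -muB0; change (P (B `&` A) <= P B)%E.
  apply: le_measure; rewrite ?inE.
  - by apply: measurableI => //; exact: g_sigma_sub_measurable.
  - exact: g_sigma_sub_measurable.
  - exact: subIsetl.
pose f := Radon_Nikodym_SigmaFinite.f nu mu.
have f0 x : (0 <= f x)%E by exact: Radon_Nikodym_SigmaFinite.f_ge0.
have ffin x : f x \is a fin_num by exact: Radon_Nikodym_SigmaFinite.f_fin_num.
have fint := Radon_Nikodym_SigmaFinite.f_integrable dom.
have mf : measurable_fun [set: g_sigma_algebraType gen] f by exact: measurable_int fint.
have fE C : <<s gen >> C -> (\int[P]_(w in C) f w = P (C `&` A))%E.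
  move=> GC; rewrite -nuE (Radon_Nikodym_SigmaFinite.f_integral dom)//.
  rewrite /mu /distribution ge0_integral_pushforward//.
  exact: measurable_funTS.
have fT : <<s gen >> [set: T].
  by have [s0 sD _] := smallest_sigma_algebra [set: T] gen; have := sD _ s0; rewrite setD0.
exists (fine \o f); split.
- move=> B mB.
  have mff : measurable_fun [set: g_sigma_algebraType gen] (fine \o f).
    exact: measurableT_comp.
  by move: mff => /(_ measurableT B mB); rewrite setTI.
- apply/integrableP; split.
    apply/measurable_EFinP; apply: measurableT_comp => //.
    move=> _ B mB; rewrite setTI; apply: g_sigma_sub_measurable.
    by rewrite -(setTI (_ @^-1` _)); exact: mf.
  have -> : (\int[P]_w `|(EFin \o (fine \o f)) w| = \int[P]_w f w)%E.
    by apply: eq_integral => w _; rewrite -[RHS]gee0_abs// -[in RHS](fineK (ffin w)).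
  by rewrite fE// ltey_eq fin_num_measure//; apply: measurableI.
- move=> C GC; rewrite setIC -fE//; apply: eq_integral => w _.
  by rewrite /= fineK.
Qed.

End conditional_probability_existence.

(** * Conditional independence as orthogonality of a residual *)

Section cond_independence_tests.
Context {disp : measure_display} {T : measurableType disp} {R : realType}.
Variables (P : probability T R) (gen : set (set T)).
Hypothesis gen_measurable : gen `<=` measurable.
Implicit Types (f g W : T -> R) (A B C : set T).
Local Notation G := <<s gen >>.

Let sG : sub_sigma_algebra_of_measurable G.
Proof.
split; first exact: smallest_sigma_algebra.
by move=> A; exact: g_sigma_sub_measurable.
Qed.

Let Gm C : G C -> measurable C. Proof. by case: sG => _; exact. Qed.

Lemma measurable_wrtP f :
  measurable_wrt G f <-> measurable_fun [set: g_sigma_algebraType gen] f.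
Proof.
split => [mf _ B mB|mf B mB]; first by rewrite setTI; exact: mf.
by have := mf measurableT B mB; rewrite setTI.
Qed.

Lemma measurable_wrtM f g :
  measurable_wrt G f -> measurable_wrt G g -> measurable_wrt G (f \* g).
Proof.
by move=> /measurable_wrtP mf /measurable_wrtP mg; apply/measurable_wrtP; exact: measurable_funM.
Qed.

Lemma measurable_wrtB f g :
  measurable_wrt G f -> measurable_wrt G g -> measurable_wrt G (f \- g).
Proof.
by move=> /measurable_wrtP mf /measurable_wrtP mg; apply/measurable_wrtP; exact: measurable_funB.
Qed.

Lemma measurable_wrt_indic C : G C -> measurable_wrt G (\1_C : T -> R).
Proof.
by move=> GC; apply/measurable_wrtP; exact: (@measurable_indic _ (g_sigma_algebraType gen)).
Qed.

(** The averaging property is phrased as orthogonality of the residual 1_A - f to indicators, the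
    form to which [Rintegral_mul_measurable_wrt] applies; boundedness makes all products
    integrable. *)
Definition bounded_version A f :=
  [/\ measurable_wrt G f, bounded_measurable f &
      forall C, G C -> \int[P]_w ((\1_A w - f w) * \1_C w) = 0].

Let Rintegral_indic f C : \int[P]_(w in C) f w = \int[P]_w (f w * \1_C w).
Proof.
rewrite Rintegral_mkcond; apply: eq_Rintegral => w _.
by rewrite patchE indicE; case: (w \in C); rewrite ?mulr1 ?mulr0.
Qed.

Let P_indic A C : measurable A -> measurable C ->
  fine (P (A `&` C)) = \int[P]_w (\1_A w * \1_C w).
Proof.
move=> mA mC; rewrite -Rintegral_indic /Rintegral; congr fine.
by rewrite integral_indic.
Qed.

Lemma cond_probability_bounded_version A f : measurable A -> bounded_measurable f ->
  cond_probability P G A f <-> bounded_version A f.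
Proof.
move=> mA bf.
have bAC C : G C -> bounded_measurable (fun w => \1_A w * \1_C w : R).
  by move=> GC; apply: bounded_measurableM; apply: bounded_measurable_indic => //; exact: Gm.
have bfC C : G C -> bounded_measurable (fun w => f w * \1_C w : R).
  by move=> GC; apply: bounded_measurableM => //; apply: bounded_measurable_indic => //; exact: Gm.
have key C : G C -> \int[P]_w ((\1_A w - f w) * \1_C w) =
    fine (P (A `&` C)) - \int[P]_(w in C) f w.
  move=> GC; rewrite P_indic//; last exact: Gm.
  under eq_Rintegral do rewrite mulrBl.
  have i1 := bounded_measurable_integrable P (bAC _ GC).
  have i2 := bounded_measurable_integrable P (bfC _ GC).
  by rewrite RintegralB// (Rintegral_indic f C).
split=> [[mf _ fA]|[mf _ fA]]; split => //.
- by move=> C GC; rewrite key// /Rintegral fA// subrr.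
- exact: bounded_measurable_integrable.
- move=> C GC; have := fA _ GC; rewrite key// => /eqP; rewrite subr_eq0 => /eqP e.
  rewrite -[RHS]fineK; last first.
    by rewrite fin_num_measure//; apply: measurableI => //; exact: Gm.
  rewrite e fineK//; apply: integrable_fin_num; first exact: Gm.
  by apply: integrableS (bounded_measurable_integrable P bf) => //; exact: Gm.
Qed.

Let neg_null g : measurable_wrt G g -> P.-integrable [set: T] (EFin \o g) ->
  (forall C, G C -> 0 <= \int[P]_(w in C) (g w)%:E)%E ->
  {ae P, forall w, 0 <= g w}.
Proof.
move=> mg ig g0.
pose D := g @^-1` `]-oo, 0[%classic.
have GD : G D by apply: mg; exact: measurable_itv.
have mD := Gm GD.
have gD w : D w -> g w < 0 by rewrite /D/= in_itv.
have iD : P.-integrable D (EFin \o g) by exact: integrableS ig.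
have : (\int[P]_(w in D) `|(g w)%:E| = 0)%E.
  apply/eqP; rewrite eq_le integral_ge0// andbT.
  rewrite (_ : (\int[P]_(w in D) `|(g w)%:E|)%E = (- \int[P]_(w in D) (g w)%:E)%E).
    by rewrite oppe_le0; exact: g0.
  rewrite -integralN/=; last first.
    by apply: integrable_add_def; case/integrableP : (iD).
  by apply: eq_integral => w /set_mem/gD gw; rewrite /= ltr0_norm.
move/ae_eq_integral_abs => /(_ mD).
have mgD : measurable_fun D (EFin \o g) by case/integrableP : iD.
move=> /(_ mgD); apply: filterS => w Dw0.
rewrite leNgt; apply/negP => gw; have Dw : D w by rewrite /D /= in_itv.
by have := Dw0 Dw => /= -[g00]; rewrite g00 ltxx in gw.
Qed.

(** Since 0 <= P(A & C) <= P(C) for every C in G, f lies in [0, 1] almost surely, and clipping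
    changes it on a null set only. *)
Lemma cond_probability_clip A f : measurable A -> cond_probability P G A f ->
  exists2 g, bounded_version A g & {ae P, forall w, f w = g w}.
Proof.
move=> mA [mf fint fA].
pose g w := Num.max 0 (Num.min 1 (f w)).
have mg : measurable_wrt G g.
  move=> B mB; rewrite (_ : g @^-1` B = f @^-1` ((fun x => Num.max 0 (Num.min 1 x)) @^-1` B))//.
  apply: mf; rewrite -[X in measurable X]setTI.
  apply: (_ : measurable_fun setT _) => //.
  exact: measurable_maxr (measurable_cst _)
    (measurable_minr (measurable_cst _) (@measurable_id _ _ _)).
have bg : bounded_measurable g.
  split; first exact: measurable_wrt_measurable sG mg.
  exists 1 => w; rewrite ger0_norm ?le_max ?lexx//.
  by rewrite ge_max ler01 ge_min lexx.
have f0 : {ae P, forall w, 0 <= f w}.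
  by apply: neg_null => // C GC; rewrite fA.
have f1 : {ae P, forall w, 0 <= 1 - f w}.
  have i1 : P.-integrable [set: T] (EFin \o (fun w => 1 - f w)).
    have ic := bounded_measurable_integrable P (bounded_measurable_cst (1 : R)).
    by apply: (eq_integrable measurableT _ _ _ (integrableB measurableT ic fint)) => w _.
  apply: neg_null => //.
    by apply: (@measurable_wrtB (cst 1) f) => //; apply/measurable_wrtP; exact: measurable_cst.
  move=> C GC; have mC := Gm GC.
  under eq_integral do rewrite EFinB.
  rewrite integralB//; last 2 first.
  - apply: (@integrableS _ _ _ P setT C (fun=> 1%:E)) => //.
    exact: (bounded_measurable_integrable P (bounded_measurable_cst (1 : R))).
  - exact: integrableS fint.
  rewrite fA// integral_cst// mul1e sube_ge0 ?fin_num_measure//; last exact: measurableI.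
  by apply: le_measure; rewrite ?inE//; first exact: measurableI.
have fg : {ae P, forall w, f w = g w}.
  apply: filterS2 f0 f1 => w w0 w1.
  have w1' : f w <= 1 by rewrite -subr_ge0.
  by rewrite /g (min_r w1') (max_r w0).
exists g => //; apply/cond_probability_bounded_version => //; split => //.
  exact: bounded_measurable_integrable.
move=> C GC; rewrite -fA//; apply: ae_eq_integral; first exact: Gm.
- by apply: measurable_funTS; apply/measurable_EFinP; case: bg.
- by apply: measurable_funTS; case/integrableP : fint.
- by apply: filterS fg => w fw _ /=; rewrite fw.
Qed.

Lemma bounded_version_exists A : measurable A -> exists f, bounded_version A f.
Proof.
move=> mA; have [f] := cond_probability_Radon_Nikodym P gen_measurable mA.
move=> /(cond_probability_clip mA)[g bg _].
by exists g.
Qed.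

(** f - g is orthogonal to G and measurable for G, so it may be tested against itself. *)
Lemma bounded_version_unique A f g : measurable A ->
  bounded_version A f -> bounded_version A g -> {ae P, forall w, f w = g w}.
Proof.
move=> mA [mf bf fA] [mg bg gA].
have bfg : bounded_measurable (f \- g) by exact: bounded_measurableB.
have bA : bounded_measurable (\1_A : T -> R) by exact: bounded_measurable_indic.
have h0 C : G C -> \int[P]_w ((f \- g) w * \1_C w) = 0.
  move=> GC; rewrite -[RHS](subrr (0 : R)) -{1}(gA _ GC) -(fA _ GC).
  have bC : bounded_measurable (\1_C : T -> R) by apply: bounded_measurable_indic; exact: Gm.
  rewrite -RintegralB//; first by apply: eq_Rintegral => w _ /=; ring.
    exact/bounded_measurable_integrable/bounded_measurableM/bC/bounded_measurableB.
  exact/bounded_measurable_integrable/bounded_measurableM/bC/bounded_measurableB.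
have := Rintegral_mul_measurable_wrt sG bfg h0 (measurable_wrtB mf mg) bfg.
have b2 := bounded_measurableM bfg bfg.
have i2 := bounded_measurable_integrable P b2.
move=> e0; have : (\int[P]_w `|((f \- g) w * (f \- g) w)%:E| = 0)%E.
  transitivity (\int[P]_w ((f \- g) w * (f \- g) w)%:E)%E.
    by apply: eq_integral => w _; rewrite gee0_abs// lee_fin -expr2 sqr_ge0.
  by rewrite -[LHS]fineK ?integrable_fin_num//; congr EFin.
have m2 : measurable_fun [set: T] (fun w => ((f \- g) w * (f \- g) w)%:E) by case/integrableP : i2.
move/ae_eq_integral_abs => /(_ measurableT m2); apply: filterS => w /(_ I)/= [] /eqP.
by rewrite -expr2 sqrf_eq0 subr_eq0 => /eqP.
Qed.

Lemma ae_eq_Rintegral f g : bounded_measurable f -> bounded_measurable g ->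
  {ae P, forall w, f w = g w} -> \int[P]_w f w = \int[P]_w g w.
Proof.
move=> [mf _] [mg _] fg; congr fine; apply: ae_eq_integral => //.
- exact/measurable_EFinP.
- exact/measurable_EFinP.
- by apply: filterS fg => w fw _ /=; rewrite fw.
Qed.

(** This says P(B | F1, G) = P(B | G), tested on the events A & C. It is linear in the residual 1_B
    - g, unlike the product formula. The two are exchanged through 1_A 1_B - gA gB = (1_A - gA) gB +
    1_A (1_B - gB), whose first term has zero integral over every C in G. *)
Lemma cond_independentP (F1 F2 : set (set T)) :
  F1 `<=` measurable -> F2 `<=` measurable ->
  cond_independent P G F1 F2 <->
  forall A B g, F1 A -> F2 B -> bounded_version B g ->
    forall C, G C -> \int[P]_w ((\1_B w - g w) * (\1_A w * \1_C w)) = 0.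
Proof.
move=> mF1 mF2; split.
- move=> CI A B g FA FB bg C GC.
  have [mA mB mC] := And3 (mF1 _ FA) (mF2 _ FB) (Gm GC).
  have [fA [fB [fAB [cA cB cAB fABE]]]] := CI _ _ FA FB.
  have [gA vA eA] := cond_probability_clip mA cA.
  have [gB vB eB] := cond_probability_clip mB cB.
  have [gAB vAB eAB] := cond_probability_clip (measurableI _ _ mA mB) cAB.
  have gBE := bounded_version_unique mB vB bg.
  have ab : {ae P, forall w, gAB w = gA w * gB w}.
    apply: filterS2 (filterI eA eB) (filterI eAB fABE) => w [<- <-] [<- ->//].
  case: (vA) (vB) (vAB) (bg) => [mgA bgA hA] [mgB bgB hB] [mgAB bgAB hAB] [mg bbg hg].
  have iA := @bounded_measurable_indic _ _ R _ mA.
  have iB := @bounded_measurable_indic _ _ R _ mB.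
  have iC := @bounded_measurable_indic _ _ R _ mC.
  have iAB := @bounded_measurable_indic _ _ R _ (measurableI _ _ mA mB).
  have b1 := bounded_measurableM (bounded_measurableB iAB bgAB) iC.
  have b2 := bounded_measurableM (bounded_measurableB iA bgA) (bounded_measurableM bgB iC).
  have b3 := bounded_measurableM (bounded_measurableB iB bbg) (bounded_measurableM iA iC).
  have t2 : \int[P]_w ((\1_A w - gA w) * (gB w * \1_C w)) = 0.
    apply: (Rintegral_mul_measurable_wrt sG _ hA).
    - exact: bounded_measurableB.
    - exact: measurable_wrtM mgB (measurable_wrt_indic GC).
    - exact: bounded_measurableM.
  rewrite -[RHS](subrr (0 : R)) -{1}(hAB _ GC) -t2.
  rewrite -RintegralB//; last 2 first.
  - exact: (bounded_measurable_integrable P b1).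
  - exact: (bounded_measurable_integrable P b2).
  apply: ae_eq_Rintegral.
  - exact: b3.
  - exact: (bounded_measurableB b1 b2).
  - apply: filterS2 gBE ab => w <- -> /=.
    by rewrite indicI /=; ring.
- move=> H A B FA FB.
  have mA := mF1 _ FA; have mB := mF2 _ FB.
  have mAB := measurableI _ _ mA mB.
  have [gA vA] := bounded_version_exists mA.
  have [gB vB] := bounded_version_exists mB.
  case: (vA) (vB) => [mgA bgA hA] [mgB bgB hB].
  have bAB := bounded_measurableM bgA bgB.
  exists gA, gB, (gA \* gB); split.
  - exact/(cond_probability_bounded_version mA bgA).
  - exact/(cond_probability_bounded_version mB bgB).
  - apply/(cond_probability_bounded_version mAB bAB); split => //.
      exact: measurable_wrtM.
    move=> C GC.
    have iA := @bounded_measurable_indic _ _ R _ mA.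
    have iB := @bounded_measurable_indic _ _ R _ mB.
    have iC := @bounded_measurable_indic _ _ R _ (Gm GC).
    have b2 := bounded_measurableM (bounded_measurableB iA bgA) (bounded_measurableM bgB iC).
    have b3 := bounded_measurableM (bounded_measurableB iB bgB) (bounded_measurableM iA iC).
    have t2 : \int[P]_w ((\1_A w - gA w) * (gB w * \1_C w)) = 0.
      apply: (Rintegral_mul_measurable_wrt sG _ hA).
      - exact: bounded_measurableB.
      - exact: measurable_wrtM mgB (measurable_wrt_indic GC).
      - exact: bounded_measurableM.
    rewrite -[RHS](addr0 (0 : R)) -{1}(H _ _ _ FA FB vB _ GC) -t2.
    rewrite -RintegralD//; last 2 first.
    - exact: (bounded_measurable_integrable P b3).
    - exact: (bounded_measurable_integrable P b2).
    apply: eq_Rintegral => w _ /=.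
    by rewrite indicI /=; ring.
  - exact: aeW.
Qed.

End cond_independence_tests.

(** * Precision matrices of Gaussian vectors *)

Section positive_form.
Context {R : realFieldType} {m : nat}.
Implicit Types (a b v : 'rV[R]_m) (J A B Z : set 'I_m).

Definition mx_form (S : 'M[R]_m) a b : R := (a *m S *m b^T) 0 0.

Definition supported J a := forall i, ~ J i -> a 0 i = 0.

Definition restriction J a : 'rV[R]_m := \row_i (a 0 i *+ (i \in J)).

Lemma restriction_supported J a : supported J (restriction J a).
Proof. by move=> i Ji; rewrite mxE memNset// mulr0n. Qed.

Lemma supportedD J a b : supported J a -> supported J b -> supported J (a + b).
Proof. by move=> Ja Jb i Ji; rewrite mxE Ja// Jb// addr0. Qed.

Lemma supportedZ J (c : R) a : supported J a -> supported J (c *: a).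
Proof. by move=> Ja i Ji; rewrite mxE Ja// mulr0. Qed.

Lemma supportedB J a b : supported J a -> supported J b -> supported J (a - b).
Proof. by move=> Ja Jb i Ji; rewrite !mxE Ja// Jb// subr0. Qed.

Lemma supportedS J J' a : J `<=` J' -> supported J a -> supported J' a.
Proof. by move=> JJ Ja i Ji; apply: Ja => /JJ. Qed.

Lemma supported_delta J i : J i -> supported J (delta_mx 0 i).
Proof.
move=> Ji k Jk; rewrite mxE eqxx/=; case: eqP => // e; by subst k.
Qed.

Lemma supportedU_split J J' a : supported (J `|` J') a ->
  exists b c, [/\ supported J b, supported J' c & a = b + c].
Proof.
move=> JJa; exists (restriction J a), (a - restriction J a); split.
- exact: restriction_supported.
- move=> i J'i; rewrite !mxE.
  have [|/negP] := boolP (i \in J); first by rewrite mulr1n subrr.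
  by rewrite inE => Ji; rewrite mulr0n subr0; apply: JJa => -[].
- by rewrite addrC subrK.
Qed.

Variable S : 'M[R]_m.
Hypotheses (S_sym : S^T = S) (S_ge0 : forall a, 0 <= mx_form S a a).
Local Notation ip := (mx_form S).

Lemma mx_formC a b : ip a b = ip b a.
Proof.
have -> : ip a b = (a *m S *m b^T)^T 0 0 by rewrite mxE.
by rewrite !trmx_mul trmxK S_sym mulmxA.
Qed.

Lemma mx_formDl a a' b : ip (a + a') b = ip a b + ip a' b.
Proof. by rewrite /mx_form !mulmxDl mxE. Qed.

Lemma mx_formZl (c : R) a b : ip (c *: a) b = c * ip a b.
Proof. by rewrite /mx_form -!scalemxAl mxE. Qed.

Lemma mx_formBl a a' b : ip (a - a') b = ip a b - ip a' b.
Proof. by rewrite -scaleN1r mx_formDl mx_formZl mulN1r. Qed.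

Lemma mx_formDr a b b' : ip a (b + b') = ip a b + ip a b'.
Proof. by rewrite mx_formC mx_formDl !(mx_formC a). Qed.

Lemma mx_formZr (c : R) a b : ip a (c *: b) = c * ip a b.
Proof. by rewrite mx_formC mx_formZl (mx_formC a). Qed.

Lemma mx_formBr a b b' : ip a (b - b') = ip a b - ip a b'.
Proof. by rewrite mx_formC mx_formBl !(mx_formC a). Qed.

Lemma mx_form_delta a i : ip a (delta_mx 0 i) = (a *m S) 0 i.
Proof. by rewrite /mx_form trmx_delta -colE mxE. Qed.

Hypothesis S_unit : S \in unitmx.

Lemma mx_form_definite a : ip a a = 0 -> a = 0.
Proof.
move=> a0.
have ab b : ip a b = 0.
  have bb := S_ge0 b.
  have h (t : R) : 0 <= 2 * t * ip a b + t ^+ 2 * ip b b.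
    have := S_ge0 (a + t *: b).
    rewrite mx_formDl !mx_formDr !mx_formZl !mx_formZr a0 (mx_formC b a).
    by rewrite add0r; congr (_ <= _); ring.
  (* Adding 1 avoids dividing by [ip b b], which might vanish. At t = - [ip a b] / c the nonnegative
     quadratic equals - ([ip a b])^2 (c + 1) / c^2, forcing [ip a b] = 0. *)
  pose c := ip b b + 1.
  have c0 : 0 < c by rewrite /c; lra.
  have := h (- ip a b / c).
  have -> : 2 * (- ip a b / c) * ip a b + (- ip a b / c) ^+ 2 * ip b b =
      - (ip a b) ^+ 2 * ((c + 1) / c ^+ 2).
    rewrite /c; field; rewrite -/c; lra.
  rewrite mulNr oppr_ge0 pmulr_lle0; last by rewrite divr_gt0 ?exprn_gt0//; lra.
  by move=> h2; apply/eqP; rewrite -sqrf_eq0 eq_le h2 sqr_ge0.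
have aS0 : a *m S = 0.
  by apply/rowP => i; rewrite -mx_form_delta ab mxE.
by rewrite -(mulmxK S_unit a) aS0 mul0mx.
Qed.

(** The normal equations are solved without extracting a submatrix: with D the coordinate projection
    onto J, [M] = D S D + (1 - D) is the J block of S completed by an identity. It is invertible
    because v M = 0 makes v D isotropic for S, hence zero, and then v = 0. *)
Lemma orthogonal_projection J a :
  exists z, supported J z /\ forall b, supported J b -> ip (a - z) b = 0.
Proof.
pose D : 'M[R]_m := diag_mx (\row_i (i \in J)%:R).
have rD v i : (v *m D) 0 i = v 0 i * (i \in J)%:R.
  by rewrite mul_mx_diag !mxE.
have DT : D^T = D by rewrite /D tr_diag_mx.
have DD : D *m D = D.
  rewrite /D mulmx_diag; congr diag_mx; apply/rowP => i; rewrite !mxE.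
  by case: (i \in J); rewrite ?mulr1 ?mulr0.
have sD v : supported J (v *m D) by move=> i Ji; rewrite rD memNset// mulr0.
have Ds v : supported J v -> v *m D = v.
  move=> Jv; apply/rowP => i; rewrite rD.
  have [|/negP] := boolP (i \in J); first by rewrite mulr1.
  by rewrite inE => /Jv ->; rewrite mul0r.
pose M := D *m S *m D + (1%:M - D).
have M_unit : M \in unitmx.
  rewrite -row_free_unit -kermx_eq0; apply/eqP/row_matrixP => i.
  set v := row i (kermx M); rewrite row0.
  have vM : v *m M = 0 by rewrite -row_mul mulmx_ker row0.
  have vD : (v *m D) *m S *m D = 0.
    have := congr1 (fun u => u *m D) vM.
    by rewrite mul0mx /M mulmxDr mulmxDl mulmxBr mulmx1 mulmxBl -!mulmxA DD subrr addr0.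
  have vD0 : v *m D = 0.
    apply: mx_form_definite; rewrite /mx_form trmx_mul DT mulmxA vD mul0mx mxE//.
  have := vM; rewrite /M mulmxDr mulmxBr mulmx1 vD0 subr0.
  by rewrite -!mulmxA [D *m _]mulmxA !mulmxA vD0 !mul0mx add0r.
exists (a *m S *m D *m invmx M).
set z := _ *m invmx M.
have zM : z *m M = a *m S *m D by rewrite /z mulmxKV.
have zD : z *m D = z.
  have D1 : D *m (1%:M - D) = 0 by rewrite mulmxBr mulmx1 DD subrr.
  have M1 : M *m (1%:M - D) = 1%:M - D.
    by rewrite /M mulmxDl -mulmxA D1 mulmx0 add0r mulmxBl mul1mx D1 subr0.
  have : z *m M *m (1%:M - D) = 0 by rewrite zM -(mulmxA (a *m S)) D1 mulmx0.
  by rewrite -mulmxA M1 mulmxBr mulmx1 => /eqP; rewrite subr_eq0 => /eqP.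
have zSD : (a - z) *m S *m D = 0.
  apply/eqP; rewrite !mulmxBl subr_eq0 -zM /M mulmxDr mulmxBr mulmx1 zD subrr addr0.
  by rewrite !mulmxA zD.
split; first by rewrite -zD; exact: sD.
move=> b /Ds <-; rewrite /mx_form trmx_mul DT mulmxA zSD mul0mx mxE//.
Qed.

(* Equivalently: the [(A, B)] block of the Schur complement of the [Z] block
   of [S], i.e. the conditional covariance given [Z], is zero. *)
Definition separates A Z B := forall v, supported (A `|` Z) v ->
  (forall z, supported Z z -> ip v z = 0) ->
  forall b, supported B b -> ip v b = 0.

(** The rows of Q = S^-1 form the basis dual to the coordinates: [ip (row i Q) b] is the i-th entry
    of b. Separation is thus compared with the supports of these rows. *)
Lemma separates_precision A Z B :
  (forall i, [\/ A i, Z i | B i]) -> (forall i, B i -> ~ (A i \/ Z i)) ->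
  (forall i, A i -> ~ Z i) ->
  separates A Z B <-> (forall i j, A i -> B j -> invmx S i j = 0).
Proof.
move=> cov disjB disjA; set Q := invmx S.
have Q_sym : Q^T = Q by rewrite /Q trmx_inv S_sym.
have ip_dual i b : ip (row i Q) b = b 0 i.
  by rewrite /mx_form -row_mul mulVmx// rowE mulmx1 -rowE !mxE.
split=> [sep i j Ai Bj|Q0 v AZv vZ b Bb].
- have all_ : supported ((A `|` Z) `|` B) (row j Q).
    by move=> k nk; case: nk; case: (cov k) => [Ak|Zk|Bk]; [left; left|left; right|right].
  have [ab [g [AZab Bg jE]]] := supportedU_split all_.
  have [z [Zz gz]] := orthogonal_projection Z g.
  have gA a : supported A a -> ip (g - z) a = 0.
    move=> Aa; have [z' [Zz' az']] := orthogonal_projection Z a.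
    have AZ : supported (A `|` Z) (a - z').
      by apply: supportedB; [apply: supportedS Aa|apply: supportedS Zz']; [left|right].
    rewrite -(subrK z' a) mx_formDr (gz _ Zz') addr0 mx_formBl.
    by rewrite mx_formC (sep _ AZ az' _ Bg) mx_formC (az' _ Zz) subrr.
  (* u is supported on A and Z. It is orthogonal to A and Z, as both [row j Q] and g - z are; so u
     is isotropic and vanishes. Then [row j Q] = g - z has no entry in A. *)
  pose u := row j Q - (g - z).
  have AZu : supported (A `|` Z) u.
    rewrite /u jE opprB addrA addrAC addrK.
    by apply: supportedD => //; apply: supportedS Zz; right.
  have uu : ip u u = 0.
    rewrite {1}/u mx_formBl ip_dual AZu ?sub0r; last exact: disjB.
    have [a [c [Aa Zc ->]]] := supportedU_split AZu.
    by rewrite mx_formDr gA// gz// addr0 oppr0.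
  have /eqP := mx_form_definite uu; rewrite subr_eq0 => /eqP jgz.
  have -> : Q i j = Q^T j i by rewrite mxE.
  rewrite Q_sym; have <- : row j Q 0 i = Q j i by rewrite mxE.
  rewrite jgz !mxE Bg ?Zz ?subrr//; first exact: disjA.
  by move=> Bi; apply: (disjB _ Bi); left.
- set c := v *m S.
  have vE : v = c *m Q by rewrite /c mulmxK.
  have cZ k : Z k -> c 0 k = 0.
    by move=> Zk; rewrite -mx_form_delta vZ//; exact: supported_delta.
  (* As Q has no (A, B) block and c vanishes on Z, the entries of cB Q at B are those of c Q = v,
     namely 0. So the form of Q vanishes at cB, and definiteness gives cB = 0. *)
  set cB := restriction B c.
  have cBQ j : B j -> (cB *m Q) 0 j = 0.
    move=> Bj; transitivity ((c *m Q) 0 j); last first.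
      by rewrite -vE AZv//; exact: disjB.
    rewrite !mxE; apply: eq_bigr => k _; rewrite mxE.
    case: (cov k) => [Ak|Zk|Bk].
    + by rewrite Q0// !mulr0.
    + by rewrite cZ// mul0rn.
    + by rewrite mem_set// mulr1n.
  have cB0 : cB *m Q = 0.
    apply: mx_form_definite.
    rewrite /mx_form trmx_mul Q_sym mulmxKV// mulmxA mxE big1// => j _.
    have [Bj|Bj] := EM (B j); first by rewrite cBQ// mul0r.
    by rewrite [X in _ * X]mxE restriction_supported// mulr0.
  have {}cB0 : cB = 0 by rewrite -(mulmxKV S_unit cB) -/Q cB0 mul0mx.
  rewrite /mx_form -/c mxE big1// => j _.
  have [Bj|Bj] := EM (B j); last by rewrite [X in _ * X]mxE Bb// mulr0.
  have <- : cB 0 j = c 0 j by rewrite mxE mem_set// mulr1n.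
  by rewrite cB0 mxE mul0r.
Qed.

End positive_form.

(** * Linear combinations of the coordinates of a centered Gaussian vector *)

Section gaussian_vector.
Context {disp : measure_display} {T : measurableType disp} {R : realType}.
Variables (P : probability T R) (m : nat) (X : T -> 'cV[R]_m).
Hypotheses (X_gaussian : jointly_gaussian P X) (X_mean : zero_mean P X).

Definition lin_comb (a : 'rV[R]_m) (w : T) : R := (a *m X w) 0 0.
Local Notation xi := lin_comb.

Definition covR : 'M[R]_m := map_mx fine (covariance_mx P X X).
Local Notation S := covR.

Local Notation cov_form := (mx_form S).

Lemma lin_combE a w : xi a w = \sum_i a 0 i * X w i 0.
Proof. by rewrite /xi mxE. Qed.

Lemma lin_combD a b : xi (a + b) = xi a \+ xi b.
Proof. by apply/funext => w; rewrite /xi mulmxDl mxE. Qed.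

Lemma lin_combZ c a : xi (c *: a) = (fun w => c * xi a w).
Proof. by apply/funext => w; rewrite /xi -scalemxAl mxE. Qed.

Lemma lin_comb0 : xi 0 = cst 0.
Proof. by apply/funext => w; rewrite /xi mul0mx mxE. Qed.

Lemma lin_comb_delta i : xi (delta_mx 0 i) = (fun w => X w i 0).
Proof. by apply/funext => w; rewrite /xi -rowE mxE. Qed.

Lemma measurable_lin_comb a : measurable_fun [set: T] (xi a).
Proof. by have [] := X_gaussian a. Qed.

Let X_Lfun i : (fun w => X w i 0) \in Lfun P 2%:E.
Proof.
rewrite -lin_comb_delta.
have [] // := gaussian_centered (X_gaussian (delta_mx 0 i)) _.
by rewrite -[X in 'E_P[X]%E]/(xi _) lin_comb_delta; exact: X_mean.
Qed.

Let P_fin : P [set: T] \is a fin_num. Proof. exact: fin_num_measure. Qed.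

Let lin_comb_Lfun a : xi a \in Lfun P 2%:E.
Proof.
rewrite (_ : xi a = \sum_i (a 0 i \o* (fun w => X w i 0))).
  apply: (big_ind (fun f : T -> R => f \in Lfun P 2%:E)).
  - exact: (Lfun_cst P 0 2).
  - by move=> f g fL gL; rewrite rpredD ?lee1n.
  - by move=> i _; apply: Lfun_scale; rewrite ?ler1n.
by apply/funext => w; rewrite lin_combE fct_sumE; apply: eq_bigr => i _ /=; rewrite mulrC.
Qed.

Lemma lin_comb_mean a : ('E_P[xi a] = 0)%E.
Proof.
rewrite (_ : xi a = \sum_(f <- [seq a 0 i \o* (fun w => X w i 0) | i <- index_enum 'I_m]) f).
  rewrite expectation_sum; last first.
    move=> f /mapP[i _ ->]; apply: Lfun_scale; rewrite ?ler1n//.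
    exact: Lfun_subset12.
  rewrite big_map big1// => i _; rewrite expectationZl; last exact: Lfun_subset12.
  by rewrite X_mean mule0.
rewrite big_map; apply/funext => w; rewrite lin_combE fct_sumE.
by apply: eq_bigr => i _ /=; rewrite mulrC.
Qed.

Lemma Rintegral_lin_combM a b : \int[P]_w (xi a w * xi b w) = cov_form a b.
Proof.
have iXX i j : P.-integrable [set: T] (fun w => (X w i 0 * X w j 0)%:E).
  by apply/Lfun1_integrable; exact: (Lfun2_mul_Lfun1 (X_Lfun i) (X_Lfun j)).
have XX i j : \int[P]_w (X w i 0 * X w j 0) = S i j.
  rewrite !mxE covarianceE.
  - rewrite !X_mean mul0e sube0 /Rintegral; congr fine.
    by rewrite unlock.
  - exact: Lfun_subset12.
  - exact: Lfun_subset12.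
  - exact: (Lfun2_mul_Lfun1 (X_Lfun i) (X_Lfun j)).
have sumE (I : Type) (s : seq I) (F : I -> T -> R) :
    (forall i, P.-integrable [set: T] (EFin \o F i)) ->
    P.-integrable [set: T] (fun w => (\sum_(i <- s) F i w)%:E) /\
    \int[P]_w (\sum_(i <- s) F i w) = \sum_(i <- s) \int[P]_w F i w.
  move=> iF; elim: s => [|i s [IH1 IH2]].
    under eq_fun do rewrite big_nil.
    split; first exact: (bounded_measurable_integrable P (bounded_measurable_cst (0 : R))).
    under eq_Rintegral do rewrite big_nil.
    by rewrite big_nil /Rintegral integral0.
  have e : (fun w => (\sum_(i <- i :: s) F i w)%:E) =
      (fun w => (F i w)%:E + (\sum_(i <- s) F i w)%:E)%E.
    by apply/funext => w; rewrite big_cons EFinD.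
  split; first by rewrite e; exact: (integrableD measurableT (iF i) IH1).
  under eq_Rintegral do rewrite big_cons.
  by rewrite RintegralD ?IH2 ?big_cons//; exact: iF.
have e w : xi a w * xi b w = \sum_i \sum_j (a 0 i * b 0 j) * (X w i 0 * X w j 0).
  rewrite !lin_combE mulr_suml; apply: eq_bigr => i _.
  by rewrite mulr_sumr; apply: eq_bigr => j _; ring.
under eq_Rintegral do rewrite e.
have iZ i j : P.-integrable [set: T] (EFin \o (fun w => (a 0 i * b 0 j) * (X w i 0 * X w j 0))).
  exact: (integrableZl measurableT (a 0 i * b 0 j) (iXX i j)).
pose F i w := \sum_j (a 0 i * b 0 j) * (X w i 0 * X w j 0).
have FE i := sumE _ (index_enum 'I_m) _ (iZ i).
have [_ ->] := sumE _ (index_enum 'I_m) F (fun i => proj1 (FE i)).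
rewrite /mx_form mxE.
under eq_bigr => i _ do rewrite (proj2 (FE i)).
rewrite exchange_big/=; apply: eq_bigr => j _.
rewrite !mxE mulr_suml; apply: eq_bigr => i _.
rewrite RintegralZl//; last exact: iXX.
by rewrite XX; ring.
Qed.

Lemma covariance_lin_comb a b : covariance P (xi a) (xi b) = (cov_form a b)%:E.
Proof.
have i2 := Lfun2_mul_Lfun1 (lin_comb_Lfun a) (lin_comb_Lfun b).
rewrite covarianceE; [|exact: Lfun_subset12|exact: Lfun_subset12|exact: i2].
rewrite !lin_comb_mean mul0e sube0 -Rintegral_lin_combM /Rintegral fineK.
  by rewrite unlock.
by apply: integrable_fin_num => //; exact/Lfun1_integrable.
Qed.

Lemma Rintegral_cos_lin_comb a th :
  \int[P]_w cos (xi a w + th) = cos th * expR (- cov_form a a / 2).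
Proof.
have [_ ->] := gaussian_centered (X_gaussian a) (lin_comb_mean a).
by rewrite -Rintegral_lin_combM.
Qed.

Lemma covR_sym : S^T = S.
Proof. by apply/matrixP => i j; rewrite !mxE covarianceC. Qed.

Lemma cov_form_ge0 a : 0 <= cov_form a a.
Proof.
by rewrite -Rintegral_lin_combM; apply: Rintegral_ge0 => w _; rewrite -expr2 sqr_ge0.
Qed.

End gaussian_vector.

(** * Conditional independence of coordinates and separation in the covariance form *)

Section gaussian_conditional_independence.
Context {disp : measure_display} {T : measurableType disp} {R : realType}.
Variables (P : probability T R) (m : nat) (X : T -> 'cV[R]_m).
Hypothesis X_ZMNG : ZMNG P X.
Implicit Types (A B Z J : set 'I_m) (a b v : 'rV[R]_m).

Local Notation xi := (lin_comb X).
Local Notation S := (covR P X).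
Local Notation ip := (mx_form S).

Let gX : jointly_gaussian P X. Proof. by case: X_ZMNG. Qed.
Let X0 : zero_mean P X. Proof. by case: X_ZMNG. Qed.
Let S_unit : S \in unitmx. Proof. by case: X_ZMNG. Qed.
Let S_sym := covR_sym P X.
Let S_ge0 := cov_form_ge0 gX X0.

Definition coord_gen J : set (set T) :=
  [set E | exists i (B : set R),
     [/\ J i, measurable B & E = (fun w => X w i 0) @^-1` B] ].

Local Notation sig J := <<s coord_gen J >>.

Let Xm i : measurable_fun [set: T] (fun w => X w i 0).
Proof. by rewrite -lin_comb_delta; exact: measurable_lin_comb. Qed.

Lemma coord_gen_measurable J : coord_gen J `<=` measurable.
Proof.
by move=> _ [i [B [_ mB ->]]]; rewrite -[X in measurable X]setTI; exact: Xm.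
Qed.

Let sigJ J : sub_sigma_algebra_of_measurable (sig J).
Proof.
split; first exact: smallest_sigma_algebra.
by move=> E; apply: g_sigma_sub_measurable; exact: coord_gen_measurable.
Qed.

Lemma sig_mono J J' : J `<=` J' -> sig J `<=` sig J'.
Proof.
by move=> JJ; apply: sub_sigma_algebra2 => _ [i [B [/JJ Ji mB ->]]]; exists i, B.
Qed.

Lemma measurable_wrt_mono J J' (f : T -> R) : J `<=` J' ->
  measurable_wrt (sig J) f -> measurable_wrt (sig J') f.
Proof. by move=> /sig_mono JJ mf B mB; apply: JJ; exact: mf. Qed.

Lemma measurable_wrt_lin_comb J a : supported J a -> measurable_wrt (sig J) (xi a).
Proof.
move=> Ja; apply/measurable_wrtP.
rewrite (_ : xi a = (fun w => \sum_i a 0 i * X w i 0)); last first.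
  by apply/funext => w; rewrite lin_combE.
apply: measurable_sum => i.
have [Ji|/Ja a0] := EM (J i).
  apply: measurable_funM; first exact: measurable_cst.
  apply/measurable_wrtP => B mB; apply: sub_sigma_algebra.
  by exists i, B.
rewrite a0 (_ : (fun _ => _) = cst 0); first exact: measurable_cst.
by apply/funext => w; rewrite mul0r.
Qed.

Lemma measurable_wrt_cos J a th : supported J a ->
  measurable_wrt (sig J) (fun w => cos (xi a w + th)).
Proof.
move=> /measurable_wrt_lin_comb/measurable_wrtP mx; apply/measurable_wrtP.
apply: (@measurableT_comp _ _ _ _ _ _ (fun x : R => cos (x + th))) => //.
apply: continuous_measurable_fun => x; apply: continuous_comp; last exact: continuous_cos.
by apply: cvgD; [exact: cvg_id|exact: cvg_cst].
Qed.

Definition lin_span J : set (T -> R) := [set h | exists2 a, supported J a & h = xi a].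

Lemma linear_family_lin_span J : linear_family (lin_span J).
Proof.
split.
- by exists 0; [move=> i _; rewrite mxE|rewrite lin_comb0].
- move=> _ _ [a Ja ->] [b Jb ->]; exists (a + b); last by rewrite lin_combD.
  exact: supportedD.
- move=> c _ [a Ja ->]; exists (c *: a); last by rewrite lin_combZ.
  exact: supportedZ.
- by move=> _ [a _ ->]; exact: measurable_lin_comb.
Qed.

Lemma trigonometric_uniqueness_coord J (W : T -> R) : bounded_measurable W ->
  (forall a th, supported J a -> \int[P]_w (W w * cos (xi a w + th)) = 0) ->
  forall E, sig J E -> \int[P]_w (W w * \1_E w) = 0.
Proof.
move=> bW W0 E JE.
apply: (trigonometric_uniqueness (linear_family_lin_span J) bW).
  by move=> _ th [a Ja ->]; exact: W0.
move: JE; apply: sub_sigma_algebra2 => _ [i [B [Ji mB ->]]].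
exists (fun w => X w i 0), B; split => //.
exists (delta_mx 0 i); first exact: supported_delta.
by rewrite lin_comb_delta.
Qed.

Let bcos a th : bounded_measurable (fun w => cos (xi a w + th)).
Proof. by apply: bounded_measurable_cos; exact: measurable_lin_comb. Qed.

Let bint (f : T -> R) : bounded_measurable f -> P.-integrable [set: T] (EFin \o f).
Proof. exact: bounded_measurable_integrable. Qed.

Lemma Rintegral_cosM a b th ph :
  \int[P]_w (cos (xi a w + th) * cos (xi b w + ph)) =
  2^-1 * (cos (th + ph) * expR (- ip (a + b) (a + b) / 2)
        + cos (th - ph) * expR (- ip (a - b) (a - b) / 2)).
Proof.
rewrite -!(Rintegral_cos_lin_comb gX X0).
rewrite -RintegralD//; [|exact: bint|exact: bint].
rewrite -RintegralZl//; last first.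
  exact: (bint (bounded_measurableD (bcos (a + b) (th + ph)) (bcos (a - b) (th - ph)))).
apply: eq_Rintegral => w _.
rewrite lin_combD -scaleN1r lin_combD lin_combZ /=.
have -> : xi a w + xi b w + (th + ph) = (xi a w + th) + (xi b w + ph) by ring.
have -> : xi a w + -1 * xi b w + (th - ph) = (xi a w + th) - (xi b w + ph) by ring.
by move: (xi a w + th) (xi b w + ph) => s t; rewrite cosD cosB; field.
Qed.

(** When v is orthogonal to b, v + b and v - b have the same variance, the sum of those of v and b,
    so E(cos cos) factors. The centered cosine of v is then orthogonal to all cosines over J, hence
    to all bounded functions of these coordinates. *)
Lemma orthogonal_cos_independent J v th (f : T -> R) :
  (forall b, supported J b -> ip v b = 0) ->
  measurable_wrt (sig J) f -> bounded_measurable f ->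
  \int[P]_w (cos (xi v w + th) * f w) =
  \int[P]_w cos (xi v w + th) * \int[P]_w f w.
Proof.
move=> vJ mf bf.
set c := \int[P]_w cos (xi v w + th).
have bW : bounded_measurable (fun w => cos (xi v w + th) - c).
  by apply: (bounded_measurableB (bcos v th)); exact: bounded_measurable_cst.
have W0 b ph : supported J b ->
    \int[P]_w ((cos (xi v w + th) - c) * cos (xi b w + ph)) = 0.
  move=> Jb.
  under eq_Rintegral do rewrite mulrBl.
  rewrite RintegralB//; last 2 first.
  - exact: (bint (bounded_measurableM (bcos v th) (bcos b ph))).
  - exact: (bint (bounded_measurableM (bounded_measurable_cst c) (bcos b ph))).
  rewrite RintegralZl//; last exact: bint.
  rewrite Rintegral_cosM /c !(Rintegral_cos_lin_comb gX X0).
  rewrite !(mx_formBl, mx_formDl) !(mx_formBr S_sym, mx_formDr S_sym).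
  rewrite (mx_formC S_sym b v) (vJ _ Jb) addr0 add0r subr0 sub0r opprK.
  by rewrite opprD mulrDl expRD cosD cosB; field.
have := Rintegral_mul_measurable_wrt (sigJ J) bW (trigonometric_uniqueness_coord bW W0) mf bf.
under eq_Rintegral do rewrite mulrBl.
rewrite RintegralB//; last 2 first.
- exact: (bint (bounded_measurableM (bcos v th) bf)).
- exact: (bint (bounded_measurableM (bounded_measurable_cst c) bf)).
rewrite RintegralZl//; last exact: bint.
by move/eqP; rewrite subr_eq0 => /eqP.
Qed.


Let sin_shift (x : R) : sin x = cos (x + (- (pi / 2))).
Proof. by rewrite cosB cos_pihalf sin_pihalf mulr0 add0r mulr1. Qed.

Let cos_lin_combD a b th w : cos (xi (a + b) w + th) =
  cos (xi a w + 0) * cos (xi b w + th)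
  - cos (xi a w + - (pi / 2)) * cos (xi b w + (th - pi / 2)).
Proof.
rewrite addr0 addrA -!sin_shift lin_combD /=.
have -> : xi a w + xi b w + th = xi a w + (xi b w + th) by ring.
by rewrite cosD.
Qed.

Let Rintegral_cos_split (W : T -> R) a b th : bounded_measurable W ->
  \int[P]_w (W w * cos (xi (a + b) w + th)) =
  \int[P]_w (W w * (cos (xi a w + 0) * cos (xi b w + th)))
  - \int[P]_w (W w * (cos (xi a w + - (pi / 2)) * cos (xi b w + (th - pi / 2)))).
Proof.
move=> bW; rewrite -RintegralB//; last 2 first.
- exact: (bint (bounded_measurableM bW (bounded_measurableM (bcos a 0) (bcos b th)))).
- exact: (bint (bounded_measurableM bW (bounded_measurableM (bcos a _) (bcos b _)))).
by apply: eq_Rintegral => w _; rewrite cos_lin_combD mulrBr.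
Qed.

Let subUl (I : Type) (J J' : set I) : J `<=` J `|` J'. Proof. by left. Qed.
Let subUr (I : Type) (J J' : set I) : J' `<=` J `|` J'. Proof. by right. Qed.

(** Test W = 1_F - g on cosines over A and Z. Splitting a = (a - z) + z with z the projection onto
    Z, the part a - z is orthogonal to B and Z, so its cosine factors out of the expectation; what
    remains, W against a function of Z, has mean zero because g is a version of P(F | Z). *)
Lemma gaussian_separates_cond_independent A Z B : separates S A Z B ->
  cond_independent P (sig Z) (sig A) (sig B).
Proof.
have [_ mA] := sigJ A; have [_ mB] := sigJ B; have [_ mZ] := sigJ Z.
move=> sep; apply/(cond_independentP P (coord_gen_measurable (J := Z)) mA mB).
move=> E F g sE sF [mg bg hg] C sC.
have bF := @bounded_measurable_indic _ _ R _ (mB _ sF).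
have bW : bounded_measurable (\1_F \- g) by exact: bounded_measurableB.
have mW : measurable_wrt (sig (B `|` Z)) (\1_F \- g).
  apply: measurable_wrtB.
    apply: (measurable_wrt_mono (@subUl _ B Z)); exact: measurable_wrt_indic.
  exact: (measurable_wrt_mono (@subUr _ B Z) mg).
have AZE : sig (A `|` Z) (E `&` C).
  apply: (@measurableI _ (g_sigma_algebraType (coord_gen (A `|` Z)))).
    exact: (sig_mono (@subUl _ A Z) sE).
  exact: (sig_mono (@subUr _ A Z) sC).
transitivity (\int[P]_w ((\1_F \- g) w * \1_(E `&` C) w)).
  by apply: eq_Rintegral => w _; rewrite indicI.
move: (E `&` C) AZE; apply: trigonometric_uniqueness_coord => // a th AZa.
have [z [Zz az]] := orthogonal_projection S_sym S_ge0 S_unit Z a.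
have AZv : supported (A `|` Z) (a - z).
  by apply: supportedB => //; apply: supportedS Zz; right.
have vBZ b : supported (B `|` Z) b -> ip (a - z) b = 0.
  move=> /supportedU_split[b1 [b2 [Bb1 Zb2 ->]]].
  by rewrite (mx_formDr S_sym) (sep _ AZv az _ Bb1) az// addr0.
rewrite -(subrK z a) Rintegral_cos_split//.
have factor ph ph' : \int[P]_w ((\1_F \- g) w * (cos (xi (a - z) w + ph) * cos (xi z w + ph'))) = 0.
  have mcz : measurable_wrt (sig Z) (fun w => cos (xi z w + ph')) by exact: measurable_wrt_cos.
  transitivity (\int[P]_w (cos (xi (a - z) w + ph) * ((\1_F \- g) w * cos (xi z w + ph')))).
    by apply: eq_Rintegral => w _; ring.
  rewrite (orthogonal_cos_independent _ vBZ).
  - rewrite (Rintegral_mul_measurable_wrt (sigJ Z) bW hg mcz (bcos _ _)).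
    by rewrite mulr0.
  - apply: measurable_wrtM => //.
    exact: (measurable_wrt_mono (@subUr _ B Z) mcz).
  - exact: bounded_measurableM.
by rewrite !factor subrr.
Qed.

(** Let v be orthogonal to Z. Conditional independence replaces 1_F by g in E(cos(v) 1_F), and
    orthogonality to Z factors E(cos(v) g). So the cosine of v is uncorrelated with all events of B,
    in particular with the cosine of b. *)
Lemma gaussian_cond_independent_separates A Z B :
  cond_independent P (sig Z) (sig A) (sig B) -> separates S A Z B.
Proof.
have [_ mA] := sigJ A; have [_ mB] := sigJ B; have [_ mZ] := sigJ Z.
move=> /(cond_independentP P (coord_gen_measurable (J := Z)) mA mB) CI v AZv vZ b Bb.
have [a [c [Aa Zc vE]]] := supportedU_split AZv.
pose k := \int[P]_w cos (xi v w + 0).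
have bV : bounded_measurable (fun w => cos (xi v w + 0) - k).
  by apply: (bounded_measurableB (bcos v 0)); exact: bounded_measurable_cst.
have VF F : sig B F -> \int[P]_w ((cos (xi v w + 0) - k) * \1_F w) = 0.
  move=> sF; have bF := @bounded_measurable_indic _ _ R _ (mB _ sF).
  have [g vg] := bounded_version_exists P (coord_gen_measurable (J := Z)) (mB _ sF).
  have [mg bg hg] := vg.
  have bW : bounded_measurable (\1_F \- g) by exact: bounded_measurableB.
  have Wcos ph ph' :
      \int[P]_w ((\1_F \- g) w * (cos (xi a w + ph) * cos (xi c w + ph'))) = 0.
    transitivity (\int[P]_w (((\1_F \- g) \* (fun w => cos (xi a w + ph))) w * cos (xi c w + ph'))).
      by apply: eq_Rintegral => w _ /=; ring.
    apply: (Rintegral_mul_measurable_wrt (sigJ Z)).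
    - exact: bounded_measurableM.
    - move=> C sC; have bC := @bounded_measurable_indic _ _ R _ (mZ _ sC).
      transitivity (\int[P]_w (((\1_F \- g) \* \1_C) w * cos (xi a w + ph))).
        by apply: eq_Rintegral => w _ /=; ring.
      apply: (Rintegral_mul_measurable_wrt (sigJ A)).
      + exact: bounded_measurableM.
      + move=> E sE; rewrite -[RHS](CI _ _ _ sE sF vg _ sC).
        by apply: eq_Rintegral => w _ /=; ring.
      + exact: measurable_wrt_cos.
      + exact: bcos.
    - exact: measurable_wrt_cos.
    - exact: bcos.
  have W0 : \int[P]_w ((\1_F \- g) w * cos (xi v w + 0)) = 0.
    by rewrite vE Rintegral_cos_split// !Wcos subrr.
  have gk : \int[P]_w (cos (xi v w + 0) * g w) = k * \int[P]_w g w.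
    exact: (orthogonal_cos_independent _ vZ).
  have sT : sig Z [set: T] by exact: (@measurableT _ (g_sigma_algebraType (coord_gen Z))).
  have Fg : \int[P]_w \1_F w = \int[P]_w g w.
    have := hg _ sT; under eq_Rintegral do rewrite indicT mulr1.
    rewrite RintegralB//; last 2 first.
    - exact: (bint bF).
    - exact: (bint bg).
    by move/eqP; rewrite subr_eq0 => /eqP.
  have bcF := bounded_measurableM (bcos v 0) bF.
  have bcg := bounded_measurableM (bcos v 0) bg.
  have e : \int[P]_w (cos (xi v w + 0) * \1_F w) = k * \int[P]_w \1_F w.
    rewrite Fg -gk; apply/eqP; rewrite -subr_eq0 -RintegralB//; last 2 first.
    - exact: (bint bcF).
    - exact: (bint bcg).
    by rewrite -[X in _ == X]W0; apply/eqP; apply: eq_Rintegral => w _ /=; ring.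
  under eq_Rintegral do rewrite mulrBl.
  rewrite RintegralB//; last 2 first.
  - exact: (bint bcF).
  - exact: (bint (bounded_measurableM (bounded_measurable_cst k) bF)).
  by rewrite RintegralZl ?e ?subrr//; exact: bint.
have := Rintegral_mul_measurable_wrt (sigJ B) bV VF (measurable_wrt_cos 0 Bb) (bcos b 0).
under eq_Rintegral do rewrite mulrBl.
rewrite RintegralB//; last 2 first.
- exact: (bint (bounded_measurableM (bcos v 0) (bcos b 0))).
- exact: (bint (bounded_measurableM (bounded_measurable_cst k) (bcos b 0))).
rewrite RintegralZl//; last exact: bint.
rewrite Rintegral_cosM /k !(Rintegral_cos_lin_comb gX X0) addr0 subr0 cos0 !mul1r.
rewrite !(mx_formBl, mx_formDl) !(mx_formBr S_sym, mx_formDr S_sym) (mx_formC S_sym b v).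
set p := ip v v; set q := ip b b; set t := ip v b.
have -> : - (p + t + (t + q)) / 2 = (- p / 2) + (- q / 2) + - t by field.
have -> : - (p - t - (t - q)) / 2 = (- p / 2) + (- q / 2) + t by field.
rewrite -expRD (expRD _ t) (expRD _ (- t)) -mulrDr.
set K := expR _; have K0 : 0 < K by exact: expR_gt0.
(* Factorization amounts to (y^2 + y^-2) / 2 = 1, that is (y - 1 / y)^2 = 0, for t the covariance of
   v and b. *)
set y := expR (t / 2).
have y0 : 0 < y by exact: expR_gt0.
have -> : expR t = y ^+ 2 by rewrite /y -expRM_natl; congr expR; field.
have -> : expR (- t) = y ^- 2 by rewrite /y -expRM_natl expRN; congr (_ ^-1); congr expR; field.
move=> h.
have : (y - y^-1) ^+ 2 = 0.
  apply: (mulfI (lt0r_neq0 K0)); rewrite mulr0.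
  rewrite -[RHS](mulr0 2) -h; field; exact: lt0r_neq0.
move/eqP; rewrite sqrf_eq0 subr_eq0 => /eqP yV.
have y1 : y ^+ 2 = 1 by rewrite expr2 {2}yV divff// lt0r_neq0.
have : expR t = expR 0.
  by rewrite expR0 -y1 /y -expRM_natl; congr expR; field.
by move/expR_inj.
Qed.

Lemma gaussian_cond_independentP A Z B :
  (forall i, [\/ A i, Z i | B i]) -> (forall i, B i -> ~ (A i \/ Z i)) ->
  (forall i, A i -> ~ Z i) ->
  cond_independent P (sig Z) (sig A) (sig B) <->
  (forall i j, A i -> B j -> invmx S i j = 0).
Proof.
move=> h1 h2 h3; rewrite -(separates_precision S_sym S_ge0 S_unit h1 h2 h3).
by split; [exact: gaussian_cond_independent_separates|exact: gaussian_separates_cond_independent].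
Qed.

End gaussian_conditional_independence.

(** * Linear images and regression residuals *)

Section linear_image.
Context {disp : measure_display} {T : measurableType disp} {R : realType}.
Variables (P : probability T R) (m r : nat) (X : T -> 'cV[R]_m).
Hypothesis X_ZMNG : ZMNG P X.
Variable (B : 'M[R]_(r, m)).
Local Notation S := (covR P X).
Local Notation Y := (fun w => B *m X w).

Let gX : jointly_gaussian P X. Proof. by case: X_ZMNG. Qed.
Let X0 : zero_mean P X. Proof. by case: X_ZMNG. Qed.
Let S_unit : S \in unitmx. Proof. by case: X_ZMNG. Qed.

Lemma linear_image_coord i : (fun w => Y w i 0) = lin_comb X (row i B).
Proof. by apply/funext => w; rewrite /lin_comb -row_mul [RHS]mxE. Qed.

Lemma covR_linear_image : covR P Y = B *m S *m B^T.
Proof.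
apply/matrixP => i j.
rewrite 2!mxE !linear_image_coord (covariance_lin_comb gX X0) /mx_form /=.
rewrite -row_mul [LHS]mxE [RHS]mxE; apply: eq_bigr => k _.
by rewrite [X in X * _]mxE; congr (_ * _); rewrite !mxE.
Qed.

Lemma ZMNG_linear_image (F : 'M[R]_(m, r)) : B *m F = 1%:M -> ZMNG P Y.
Proof.
move=> BF; split.
- by move=> a; have := gX (a *m B); under eq_fun do rewrite -mulmxA.
- by move=> i; rewrite linear_image_coord; exact: lin_comb_mean.
- rewrite -[map_mx _ _]/(covR P Y) covR_linear_image.
  rewrite -row_free_unit -kermx_eq0; apply/eqP/row_matrixP => i.
  set v := row i _; rewrite row0.
  have vk : v *m (B *m S *m B^T) = 0 by rewrite -row_mul mulmx_ker row0.
  have vB : v *m B = 0.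
    apply: (mx_form_definite (covR_sym P X) (cov_form_ge0 gX X0) S_unit).
    have vk' : v *m B *m S *m B^T = 0 by rewrite -vk !mulmxA.
    by rewrite /mx_form trmx_mul mulmxA vk' mul0mx mxE.
  by rewrite -[v]mulmx1 -BF mulmxA vB mul0mx.
Qed.

(* [E] selects coordinates, and [Y] is what remains of these after regression
   on the others: its precision matrix is the corresponding block of the one
   of [X]. *)
Lemma precision_regression (E : 'M[R]_(r, m)) : B *m E^T = 1%:M ->
  B *m S *m E^T *m E = B *m S -> invmx (covR P Y) = E *m invmx S *m E^T.
Proof.
move=> BE BSE.
(* The second hypothesis says that B S vanishes outside the selected columns. It gives both B S B^T
   = B S E^T and B S E^T E S^-1 E^T = B E^T = 1. *)
have e : covR P Y *m (E *m invmx S *m E^T) = 1%:M.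
  have -> : covR P Y = B *m S *m E^T.
    rewrite covR_linear_image -[X in X *m B^T]BSE -[LHS]mulmxA.
    have -> : E *m B^T = 1%:M by rewrite -[LHS]trmxK trmx_mul trmxK BE trmx1.
    by rewrite mulmx1.
  by rewrite !mulmxA BSE mulmxK.
have /mulmx1_unit[Yu _] := e.
by rewrite -[RHS](mulKmx Yu) e mulmx1.
Qed.

End linear_image.

(** * Sequences of Gaussian vectors *)

Section stacked_sequences.
Context {disp : measure_display} {T : measurableType disp} {R : realType}.
Variables (P : probability T R) (n d : nat) (x : 'I_n -> T -> 'cV[R]_d).
Implicit Types (A Z B J : set 'I_n).

Lemma stackedE k i w : stacked x w (mxvec_index k i) 0 = x k w i 0.
Proof. by rewrite /stacked mxE mxvecE mxE. Qed.

Lemma mxvec_index_inj (k k' : 'I_n) (i i' : 'I_d) :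
  mxvec_index k i = mxvec_index k' i' -> k = k' /\ i = i'.
Proof. by move=> /cast_ord_inj/enum_rank_inj[-> ->]. Qed.

Definition blocks J : set 'I_(n * d) := [set p | exists k i, J k /\ p = mxvec_index k i].

Lemma blocks_index J k i : blocks J (mxvec_index k i) <-> J k.
Proof.
split=> [[k' [i' [Jk' /mxvec_index_inj[-> _]]]]//|Jk].
by exists k, i.
Qed.

Lemma sigma_of_stacked J : sigma_of x J = <<s coord_gen (stacked x) (blocks J) >>.
Proof.
rewrite /sigma_of; congr (smallest _ _); apply/seteqP; split => E.
- move=> [k [i [B [Jk mB ->]]]]; exists (mxvec_index k i), B; split => //.
    exact/blocks_index.
  by apply/seteqP; split => w /=; rewrite stackedE.
- move=> [_ [B [[k [i [Jk ->]]] mB ->]]]; exists k, i, B; split => //.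
  by apply/seteqP; split => w /=; rewrite stackedE.
Qed.

Definition zero_precision (k l : 'I_n) := forall i j : 'I_d,
  invmx (covR P (stacked x)) (mxvec_index k i) (mxvec_index l j) = 0.

Lemma cond_independent_precision A Z B : ZMNG_sequence P x ->
  (forall k, [\/ A k, Z k | B k]) -> (forall k, B k -> ~ (A k \/ Z k)) ->
  (forall k, A k -> ~ Z k) ->
  cond_independent P (sigma_of x Z) (sigma_of x A) (sigma_of x B) <->
  (forall k l, A k -> B l -> zero_precision k l).
Proof.
move=> Zx cov dB dA; rewrite !sigma_of_stacked (gaussian_cond_independentP Zx).
- split=> [H k l Ak Bl i j|H _ _ [k [i [Ak ->]]] [l [j [Bl ->]]]]; last exact: H.
  by apply: H; exact/blocks_index.
- move=> p; case/mxvec_indexP : p => k i.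
  by case: (cov k) => h; [apply: Or31|apply: Or32|apply: Or33]; exact/blocks_index.
- move=> p; case/mxvec_indexP : p => k i /blocks_index Bk.
  by case=> /blocks_index h; apply: (dB _ Bk); [left|right].
- by move=> p; case/mxvec_indexP : p => k i /blocks_index Ak /blocks_index; exact: dA.
Qed.

End stacked_sequences.

Section markov_precision.
Context {disp : measure_display} {T : measurableType disp} {R : realType}.
Variables (P : probability T R) (n d : nat) (x : 'I_n -> T -> 'cV[R]_d).
Hypothesis x_ZMNG : ZMNG_sequence P x.

Lemma zero_precisionC (k l : 'I_n) : zero_precision P x k l -> zero_precision P x l k.
Proof.
move=> kl i j; rewrite -(kl j i) -[in LHS](covR_sym P (stacked x)) -trmx_inv.
by rewrite mxE.
Qed.

Lemma markov_precision : markov_sequence P x <->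
  forall k i j : 'I_n, (i < k < j)%N -> zero_precision P x i j.
Proof.
have key (k : 'I_n) : cond_independent P (sigma_of x [set k])
      (sigma_of x [set i : 'I_n | (i < k)%N]) (sigma_of x [set i : 'I_n | (k < i)%N]) <->
    forall i j : 'I_n, (i < k)%N -> (k < j)%N -> zero_precision P x i j.
  apply: cond_independent_precision => //=.
  - move=> i; case: (ltngtP i k) => [_|_|/val_inj->]; [exact: Or31|exact: Or33|exact: Or32].
  - by move=> i ki [ik|ik]; move: ki; [rewrite ltnNge ltnW|rewrite ik ltnn].
  - by move=> i + ik; rewrite ik ltnn.
split=> [M k i j /andP[ik kj]|H k]; first exact: (key k).1.
by apply/key => i j ik kj; apply: (H k); rewrite ik.
Qed.

Lemma reciprocal_precision : reciprocal_sequence P x <->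
  forall j l k i : 'I_n, (j < k < l)%N -> (i < j)%N || (l < i)%N -> zero_precision P x k i.
Proof.
have key (j l : 'I_n) : (j < l)%N -> cond_independent P (sigma_of x [set j; l])
      (sigma_of x [set k : 'I_n | (j < k < l)%N])
      (sigma_of x [set k : 'I_n | (k < j)%N || (l < k)%N]) <->
    forall k i : 'I_n, (j < k < l)%N -> (i < j)%N || (l < i)%N -> zero_precision P x k i.
  move=> jl; apply: cond_independent_precision => //=.
  - move=> i; case: (ltngtP i j) => [ij|ji|/val_inj->].
    + by apply: Or33.
    + case: (ltngtP i l) => [il|li|/val_inj->].
      * exact: Or31.
      * exact: Or33.
      * by apply: Or32; right.
    + by apply: Or32; left.
  - move=> i o [/andP[ji il]|[e|e]].
    + by case/orP: o; rewrite ltnNge ltnW.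
    + by move: o; rewrite e ltnn ltnNge ltnW.
    + by move: o; rewrite e ltnn orbF ltnNge ltnW.
  - by move=> i /andP[ji il] [e|e]; [rewrite e ltnn in ji|rewrite e ltnn in il].
split=> [M j l k i jkl|H j l jl]; last first.
  by apply/(key j l jl) => k i; exact: (H j l).
have jl : (j < l)%N by case/andP: jkl; exact: ltn_trans.
exact: (key j l jl).1 (M j l jl) k i jkl.
Qed.

End markov_precision.

(** * Markov residuals after regression on one time *)

Section conditionally_markov.
Context {disp : measure_display} {T : measurableType disp} {R : realType}.
Variables (P : probability T R) (N d : nat) (x : 'I_N.+1 -> T -> 'cV[R]_d).
Hypothesis x_ZMNG : ZMNG_sequence P x.
Variables (s : 'I_N -> 'I_N.+1) (e : 'I_N.+1).
Hypotheses (s_inj : injective s) (s_neq : forall k, s k <> e)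
  (s_onto : forall k, k <> e -> exists k', k = s k').
Local Notation X := (stacked x).
Local Notation S := (covR P X).

Let gX : jointly_gaussian P X. Proof. by case: x_ZMNG. Qed.
Let X0 : zero_mean P X. Proof. by case: x_ZMNG. Qed.
Let S_unit : S \in unitmx. Proof. by case: x_ZMNG. Qed.

(** A map on flattened indices is defined by flattening the matrix of its values. *)
Let emb (p : 'I_(N * d)) : 'I_(N.+1 * d) :=
  mxvec (\matrix_(k < N, i < d) mxvec_index (s k) i) 0 p.

Let embE k i : emb (mxvec_index k i) = mxvec_index (s k) i.
Proof. by rewrite /emb mxvecE mxE. Qed.

Let emb_inj : injective emb.
Proof.
move=> p; case/mxvec_indexP : p => k i q; case/mxvec_indexP : q => l j.
by rewrite !embE => /mxvec_index_inj[/s_inj -> ->].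
Qed.

Let emb_neq p i : emb p <> mxvec_index e i.
Proof. by case/mxvec_indexP : p => k j; rewrite embE => /mxvec_index_inj[/s_neq]. Qed.

Let emb_onto q : (exists p, q = emb p) \/ (exists i, q = mxvec_index e i).
Proof.
case/mxvec_indexP : q => k i; have [->|/eqP/s_onto[k' ->]] := eqVneq k e.
  by right; exists i.
by left; exists (mxvec_index k' i); rewrite embE.
Qed.

Let E : 'M[R]_(N * d, N.+1 * d) := \matrix_(p, q) (q == emb p)%:R.

Let mulE m (A : 'M[R]_(m, _)) i p : (A *m E^T) i p = A i (emb p).
Proof.
rewrite mxE (bigD1 (emb p))//= !mxE eqxx mulr1 big1 ?addr0// => q qp.
by rewrite !mxE (negbTE qp) mulr0.
Qed.

(** The conditions on B characterize regression residuals: each entry of y is the matching entry of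
    x plus a combination of the entries of [x e], and is uncorrelated with [x e]. *)
Lemma regression_precision (y : 'I_N -> T -> 'cV[R]_d) (B : 'M[R]_(N * d, N.+1 * d)) :
  (forall w, stacked y w = B *m X w) ->
  (forall p q, B p (emb q) = (p == q)%:R) ->
  (forall p i, (B *m S) p (mxvec_index e i) = 0) ->
  ZMNG_sequence P y /\
  forall k l, zero_precision P y k l <-> zero_precision P x (s k) (s l).
Proof.
move=> yB Bemb BSe.
have yE : stacked y = (fun w => B *m X w) by apply/funext.
have BE : B *m E^T = 1%:M.
  by apply/matrixP => p q; rewrite mulE Bemb mxE.
have BSE : B *m S *m E^T *m E = B *m S.
  apply/matrixP => p q; have [[q' ->]|[i ->]] := emb_onto q.
    rewrite mxE (bigD1 q')//= mulE [E _ _]mxE eqxx mulr1 big1 ?addr0// => r rq.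
    by rewrite [E _ _]mxE (inj_eq emb_inj) eq_sym (negbTE rq) mulr0.
  rewrite BSe mxE big1// => r _; rewrite [E _ _]mxE eq_sym.
  by case: eqP => [/emb_neq//|_]; rewrite mulr0.
have Q := precision_regression x_ZMNG BE BSE.
split; first by rewrite /ZMNG_sequence yE; exact: (ZMNG_linear_image x_ZMNG BE).
move=> k l; rewrite /zero_precision.
have QE i j : invmx (covR P (stacked y)) (mxvec_index k i) (mxvec_index l j) =
    invmx S (mxvec_index (s k) i) (mxvec_index (s l) j).
  rewrite yE Q mulE embE mxE (bigD1 (emb (mxvec_index k i)))//= [E _ _]mxE eqxx mul1r.
  rewrite embE big1 ?addr0// => q qp; rewrite [E _ _]mxE embE (negbTE qp) mul0r//.
by split=> H i j; have := H i j; rewrite QE.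
Qed.

Lemma ZMNG_component (k : 'I_N.+1) : ZMNG P (x k).
Proof.
pose B : 'M[R]_(d, N.+1 * d) := \matrix_(i, q) (q == mxvec_index k i)%:R.
have -> : x k = (fun w => B *m X w).
  apply/funext => w; apply/colP => i.
  rewrite mxE (bigD1 (mxvec_index k i))//= mxE eqxx mul1r stackedE.
  by rewrite big1 ?addr0// => q qk; rewrite mxE (negbTE qk) mul0r.
apply: (@ZMNG_linear_image _ _ _ _ _ _ _ x_ZMNG B B^T).
apply/matrixP => i j; rewrite !mxE (bigD1 (mxvec_index k i))//= !mxE eqxx mul1r.
rewrite big1 ?addr0 => [|q qk]; last by rewrite !mxE (negbTE qk) mul0r.
by congr (nat_of_bool _)%:R; apply/eqP/eqP => [/mxvec_index_inj[_ //]|->].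
Qed.

Let pick_sum (f : 'I_(N.+1 * d) -> R) p : \sum_q (q == p)%:R * f q = f p.
Proof.
rewrite (bigD1 p)//= eqxx mul1r big1 ?addr0// => q qp.
by rewrite (negbTE qp) mul0r.
Qed.

Let reindex_e (f : 'I_(N.+1 * d) -> R) : (forall p, f (emb p) = 0) ->
  \sum_q f q = \sum_(i < d) f (mxvec_index e i).
Proof.
move=> f0.
rewrite (eq_bigr (fun q => \sum_(i < d) (q == mxvec_index e i)%:R * f q)).
  by rewrite exchange_big/=; apply: eq_bigr => i _; rewrite pick_sum.
move=> q _; rewrite -mulr_suml; have [[p ->]|[i ->]] := emb_onto q.
  by rewrite f0 mulr0.
rewrite (bigD1 i)//= eqxx big1 ?addr0 ?mul1r// => j ji.
by case: eqP => // /mxvec_index_inj[_ ij]; rewrite ij eqxx in ji.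
Qed.

(** The two representations differ only in the enumeration [s] of the times other than [e], so one
    statement serves both. *)
Lemma conditionally_markov_precision :
  (exists (y : 'I_N -> T -> 'cV[R]_d) (G : 'I_N -> 'M[R]_d),
     ZMNG_sequence P y /\ markov_sequence P y /\
     ZMNG P (x e) /\
     (forall k : 'I_N, uncorrelated_vectors P (x e) (y k)) /\
     (forall (k : 'I_N) (w : T), x (s k) w = y k w + G k *m x e w)) <->
  (forall k i j : 'I_N, (i < k < j)%N -> zero_precision P x (s i) (s j)).
Proof.
split.
- move=> [y [G [Zy [/(markov_precision Zy) My [_ [unc rep]]]]]] k i j ikj.
  pose g (p : 'I_(N * d)) i := mxvec (\matrix_(k < N, a < d) G k a i) 0 p.
  (* The matrix of the map x -> y, read off from y_k = x_(s k) - G_k x_e. *)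
  pose B : 'M[R]_(N * d, N.+1 * d) :=
    \matrix_(p, q) ((q == emb p)%:R - \sum_i g p i * (q == mxvec_index e i)%:R).
  have yB w : stacked y w = B *m X w.
    apply/colP => p; case/mxvec_indexP : p => k' a.
    rewrite stackedE mxE.
    transitivity (\sum_q ((q == emb (mxvec_index k' a))%:R * X w q 0
        - \sum_i g (mxvec_index k' a) i * ((q == mxvec_index e i)%:R * X w q 0))); last first.
      apply: eq_bigr => q _; rewrite [B _ _]mxE mulrBl mulr_suml; congr (_ - _).
      by apply: eq_bigr => i' _; rewrite mulrA.
    rewrite sumrB exchange_big/= (pick_sum (fun q => X w q 0)) embE stackedE.
    under eq_bigr => i' _ do
      rewrite -mulr_sumr (pick_sum (fun q => X w q 0)) stackedE {1}/g mxvecE mxE.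
    by rewrite rep [X in X - _]mxE [X in _ + X - _]mxE addrK.
  have Bemb p q : B p (emb q) = (p == q)%:R.
    rewrite mxE (inj_eq emb_inj) eq_sym big1 ?subr0// => i' _.
    by case: eqP => [/emb_neq//|_]; rewrite mulr0.
  have BSe p i' : (B *m S) p (mxvec_index e i') = 0.
    have := covariance_lin_comb gX X0 (row p B) (delta_mx 0 (mxvec_index e i')).
    rewrite mx_form_delta -row_mul [row p _ 0 _]mxE => h; apply: EFin_inj; rewrite -h.
    rewrite -linear_image_coord lin_comb_delta covarianceC.
    have -> : (fun w => X w (mxvec_index e i') 0) = (fun w => x e w i' 0).
      by apply/funext => w; rewrite stackedE.
    case/mxvec_indexP : p {h} => k' a.
    have -> : (fun w => (B *m X w) (mxvec_index k' a) 0) = (fun w => y k' w a 0).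
      by apply/funext => w; rewrite -yB stackedE.
    by have := unc k' i' a; rewrite mxE.
  have [_ H] := regression_precision yB Bemb BSe.
  exact/H/(My k).
- move=> H.
  (* z p holds the regression coefficients of coordinate p on [x e]: its entries there will be the
     matrices G, and the residuals will be y. *)
  have /choice[z zP] : forall p, exists z, supported (blocks [set e]) z /\
      forall b, supported (blocks [set e]) b -> mx_form S (delta_mx 0 (emb p) - z) b = 0.
    by move=> p; exact: (orthogonal_projection (covR_sym P X) (cov_form_ge0 gX X0) S_unit).
  pose B : 'M[R]_(N * d, N.+1 * d) := \matrix_p (delta_mx 0 (emb p) - z p).
  pose y k w : 'cV[R]_d := \col_a (B *m X w) (mxvec_index k a) 0.
  have yB w : stacked y w = B *m X w.
    by apply/colP => p; case/mxvec_indexP : p => k a; rewrite stackedE mxE.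
  have zemb p q : z p 0 (emb q) = 0.
    by apply: (zP p).1 => -[k [i [-> /emb_neq]]].
  have Bemb p q : B p (emb q) = (p == q)%:R.
    by rewrite !mxE zemb subr0 eqxx (inj_eq emb_inj) eq_sym.
  have BSe p i : (B *m S) p (mxvec_index e i) = 0.
    have -> : (B *m S) p (mxvec_index e i) = mx_form S (row p B) (delta_mx 0 (mxvec_index e i)).
      by rewrite mx_form_delta -row_mul [RHS]mxE.
    by rewrite rowK; apply: (zP p).2; apply: supported_delta; exact/blocks_index.
  have [Zy Hy] := regression_precision yB Bemb BSe.
  exists y, (fun k => \matrix_(a, i) z (mxvec_index k a) 0 (mxvec_index e i)).
  split => //; split.
    by apply/(markov_precision Zy) => k i j ikj; apply/Hy; exact: (H k).
  split; first exact: ZMNG_component.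
  split.
    move=> k i a; rewrite mxE covarianceC.
    have -> : (fun w => x e w i 0) = lin_comb X (delta_mx 0 (mxvec_index e i)).
      by rewrite lin_comb_delta; apply/funext => w; rewrite stackedE.
    have -> : (fun w => y k w a 0) = lin_comb X (row (mxvec_index k a) B).
      by rewrite -linear_image_coord; apply/funext => w; rewrite mxE.
    by rewrite (covariance_lin_comb gX X0) mx_form_delta -row_mul mxE BSe.
  move=> k w; apply/colP => a.
  rewrite [RHS]mxE [y k w a 0]mxE -[(B *m _) _ _]/((B *m X w) _ _) mxE.
  rewrite [X in _ + X]mxE.
  transitivity (\sum_q ((q == emb (mxvec_index k a))%:R * X w q 0
       - z (mxvec_index k a) 0 q * X w q 0)
     + \sum_q z (mxvec_index k a) 0 q * X w q 0).
    by rewrite sumrB subrK (pick_sum (fun q => X w q 0)) embE stackedE.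
  congr (_ + _).
    by apply: eq_bigr => q _; rewrite !mxE eqxx/= mulrBl.
  rewrite (@reindex_e (fun q => z (mxvec_index k a) 0 q * X w q 0)); last first.
    by move=> p; rewrite zemb mul0r.
  by apply: eq_bigr => i _; rewrite stackedE; congr (_ * _); rewrite mxE.
Qed.

End conditionally_markov.

(* yL k stands for y^L_k, k in [0, N-1]; the index k : 'I_N of yF and GF stands
   for the time k + 1 in [1, N], which is [lift ord0 k] in 'I_N.+1. *)
Theorem proposition4p4 (R : realType) (disp : measure_display)
    (T : measurableType disp) (P : probability T R) (N d : nat)
    (N_gt0 : (0 < N)%N) (x : 'I_N.+1 -> T -> 'cV[R]_d)
    (x_ZMNG : ZMNG_sequence P x) :
  reciprocal_sequence P x <->
  (exists (yL : 'I_N -> T -> 'cV[R]_d) (GL : 'I_N -> 'M[R]_d),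
     ZMNG_sequence P yL /\ markov_sequence P yL /\
     ZMNG P (x ord_max) /\
     (forall k : 'I_N, uncorrelated_vectors P (x ord_max) (yL k)) /\
     (forall (k : 'I_N) (w : T),
        x (widen_ord (leqnSn N) k) w = yL k w + GL k *m x ord_max w)) /\
  (exists (yF : 'I_N -> T -> 'cV[R]_d) (GF : 'I_N -> 'M[R]_d),
     ZMNG_sequence P yF /\ markov_sequence P yF /\
     ZMNG P (x ord0) /\
     (forall k : 'I_N, uncorrelated_vectors P (x ord0) (yF k)) /\
     (forall (k : 'I_N) (w : T),
        x (lift ord0 k) w = yF k w + GF k *m x ord0 w)).
Proof.
rewrite (conditionally_markov_precision x_ZMNG
  (s := widen_ord (leqnSn N)) (e := ord_max)); first last.
- move=> k kN; have kltN : (k < N)%N.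
    by rewrite ltn_neqAle -ltnS ltn_ord andbT; apply/eqP => h; apply: kN; exact: val_inj.
  by exists (Ordinal kltN); exact: val_inj.
- by move=> k /(congr1 val)/= h; have := ltn_ord k; rewrite h ltnn.
- by move=> k l /(congr1 val)/= h; exact: val_inj.
rewrite (conditionally_markov_precision x_ZMNG (s := lift ord0) (e := ord0)); first last.
- by move=> k; case: (unliftP ord0 k) => [k' -> _|->//]; exists k'.
- by move=> k h; have := neq_lift ord0 k; rewrite h eqxx.
- exact: lift_inj.
rewrite (reciprocal_precision x_ZMNG); split.
- move=> H; split=> k i j /andP[ik kj].
  (* For i < k < j < N, the interval [k, N] has j inside and i outside. *)
  + apply: zero_precisionC.
    apply: (H (widen_ord (leqnSn N) k) ord_max); rewrite /= ?ik ?kj ?ltn_ord//.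
  (* Times are shifted by one: [0, k + 1] has i + 1 inside and j + 1 outside. *)
  + by apply: (H ord0 (lift ord0 k)); rewrite /= /bump /= !add1n !ltnS ?ik ?kj ?orbT.
- move=> [HL HF] j l k i /andP[jk kl] /orP[ij|li].
  (* Here i < j < k < l, so i, j, k avoid time N, and j separates i from k in the first
     representation. *)
  + have kN : (k < N)%N by rewrite (leq_trans kl)// -ltnS.
    have jN := ltn_trans jk kN; have iN := ltn_trans ij jN.
    have eK : widen_ord (leqnSn N) (Ordinal kN) = k by exact: val_inj.
    have eI : widen_ord (leqnSn N) (Ordinal iN) = i by exact: val_inj.
    apply: zero_precisionC; rewrite -eK -eI; apply: (HL (Ordinal jN)).
    by rewrite /= ij.
  (* Here j < k < l < i, so k, l, i avoid time 0, and l separates k from i in the second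
     representation. *)
  + have unl (m : 'I_N.+1) : (j < m)%N -> exists m', m = lift ord0 m'.
      by case: (unliftP ord0 m) => [m' ->|->//]; exists m'.
    have [k' ek] := unl k jk; have [l' el] := unl l (ltn_trans jk kl).
    have [i' ei] := unl i (ltn_trans jk (ltn_trans kl li)).
    rewrite ek ei; apply: (HF l').
    by move: kl li; rewrite ek el ei /= /bump /= !add1n !ltnS => -> ->.
Qed.
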